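(* Let $d\in\mathbb{N}$, fix $0<\alpha<1/2$, let $G$ be a trace-zero GUE matrix on $\mathbb{C}^d\otimes\mathbb{C}^d$, and set \[ \rho=\frac{1}{d^2}\left(\mathbb{1}+\frac{\alpha}{d}G\right). \] Then $\mathbb{P}\big(\rho\geq 0\text{ and }\rho^\Gamma\geq 0\big)\geq 1-2e^{-c_\alpha d^2}$, where $c_\alpha>0$ is a constant depending only on $\alpha$.
   Context: Trace-zero GUE matrix on $\mathbb{C}^n$ ($n=d^2$): let $\tilde G$ be an $n\times n$ matrix with independent complex Gaussian entries of mean $0$ and variance $1$, let $G'=(\tilde G+\tilde G^\dagger)/\sqrt2$, and $G=G'-(\mathrm{tr}\,G')\mathbb{1}/n$. $\rho^\Gamma=(\mathrm{id}\otimes T)(\rho)$ with $T$ the transposition in the computational basis on the second factor $\mathbb{C}^d$. The event in the claim is that $\rho$ is a PPT state. *)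

(* Defs.v *)
From HB Require Import structures.
From mathcomp Require Import all_boot all_order all_algebra.
From mathcomp Require Import all_classical all_reals all_analysis.
From mathcomp Require Import complex mxtens.

Set Implicit Arguments.
Unset Strict Implicit.
Unset Printing Implicit Defensive.

Import Order.TTheory GRing.Theory Num.Theory.
Local Open Scope classical_set_scope.
Local Open Scope ring_scope.
Local Open Scope complex_scope.

Section Defs.
Variable R : realType.
Local Notation C := (R[i]).

Definition adjmx m n (A : 'M[C]_(m, n)) : 'M[C]_(n, m) :=
  \matrix_(i, j) conjc (A j i).

Definition hermitian n (A : 'M[C]_n) : Prop := adjmx A = A.

Definition psd n (A : 'M[C]_n) : Prop :=
  hermitian A /\ forall v : 'cV[C]_n, 0 <= (adjmx v *m A *m v) 0 0.

(** Partial transpose on the second factor of C^d (x) C^d, with the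
    computational basis |i>|j> indexed by mxtens_index (i, j) = i*d + j:
    rho^Gamma(ij, kl) = rho(il, kj). *)
Definition ptrans d (A : 'M[C]_(d * d)) : 'M[C]_(d * d) :=
  \matrix_(p, q)
    A (mxtens_index ((mxtens_unindex p).1, (mxtens_unindex q).2))
      (mxtens_index ((mxtens_unindex q).1, (mxtens_unindex p).2)).

(** G~ with independent complex Gaussian entries of mean 0 and variance 1:
    G~_{ij} = (X_{ij} + i Y_{ij}) / sqrt 2 with X, Y i.i.d. N(0,1).
    Here Z (false, i, j) = X_{ij}, Z (true, i, j) = Y_{ij}. *)
Definition Gtilde n (Z : bool * 'I_n * 'I_n -> R) : 'M[C]_n :=
  \matrix_(i, j) Complex (Z (false, i, j) / Num.sqrt 2)
                         (Z (true, i, j) / Num.sqrt 2).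

Definition gue_tr0 n (Z : bool * 'I_n * 'I_n -> R) : 'M[C]_n :=
  let Gp := ((Num.sqrt (2 : R))^-1)%:C *: (Gtilde Z + adjmx (Gtilde Z)) in
  Gp - (\tr Gp / n%:R)%:M.

Definition rho_state (alpha : R) d (Z : bool * 'I_(d * d) * 'I_(d * d) -> R)
  : 'M[C]_(d * d) :=
  ((d%:R ^+ 2)^-1)%:C *: (1%:M + (alpha / d%:R)%:C *: gue_tr0 Z).

End Defs.

Definition iid_std_normal {dT : measure_display} {T : measurableType dT}
  {R : realType} (P : probability T R) (I : finType) (X : I -> {RV P >-> R})
  : Prop :=
  (forall B : I -> set R, (forall i, measurable (B i)) ->
     P (\bigcap_(i in [set: I]) (X i @^-1` B i)) =
     (\big[*%E/1%E]_(i : I) P (X i @^-1` B i))%E) /\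
  (forall i (A : set R), measurable A ->
     distribution P (X i) A = normal_prob 0 1 A).

(* Main.v *)
Require Import Defs.
From HB Require Import structures.
From mathcomp Require Import all_boot all_order all_algebra.
From mathcomp Require Import all_classical all_reals all_analysis.
From mathcomp Require Import measurable_realfun simple_functions.
From mathcomp Require Import complex mxtens.
From mathcomp Require Import ring lra.

Set Implicit Arguments.
Unset Strict Implicit.
Unset Printing Implicit Defensive.

Import Order.TTheory GRing.Theory Num.Theory.
Import numFieldNormedType.Exports HBNNSimple.
Local Open Scope classical_set_scope.
Local Open Scope ring_scope.

(* The minimal eigenvalue of [G] is controlled by Slepian's inequality. For unit
   vectors [v], the centred Gaussian variables [- v^* G v] have covariance
   [|<v, w>|^2 - 1/n], [n = d^2]; adding an independent common Gaussian of variance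
   [1 + 1/n] makes them comparable with [Y_v = sqrt 2 <v, h>], [h] a standard Gaussian
   vector of [R^(2n)], because [|z|^2 + 1 >= 2 Re z]. Since [Y_v <= sqrt 2 |h|], a
   chi-square tail bound shows that [- v^* G v] exceeds [tau d] for some [v] with
   probability at most [2 exp (- 2 c n)] as soon as [tau > 2]. The partial transposition
   only permutes the Gaussian entries, so the same bound applies to it. Gaussian means
   are taken one variable at a time, by the averaging operators
   [gavg v f x = E f (x + s v)]. *)

(** * Gaussian integrals on the real line *)

Section StandardGaussian.
Variable R : realType.
Local Notation mu := (@lebesgue_measure R).
Local Notation gam := (@normal_prob R 0 1).

(** The spectrum of [G] has its edge near [-2d], so covering every [alpha < 1/2] leaves no slack in
    the constant 2 of [tau > 2]; a union bound over a net would lose a constant factor. Slepian's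
    comparison gives [sqrt 2 |h|] with [|h|] close to [sqrt (2n)], that is [2d]. It is applied to
    finite families of unit vectors only; its bound does not depend on their number, so it passes to
    a countable dense family. The indicator of the event that all coordinates are small is replaced
    by a product of decreasing cut-offs, whose mixed second derivatives are nonnegative. Smoothness
    is recorded by uniform Taylor remainders, because these survive Gaussian averaging with the same
    constant. The common Gaussian costs a factor 2, as its sign is favourable at least half of the
    time. Each of [rho] and its partial transpose fails to be positive with probability at most
    [2 x^2], where [x = exp (- c n)]; the square pays for adding the two failures, since
    [4 x^2 <= 2 x] once [x <= 1/2]. *)

Lemma ge0_integral_normal_prob (m s : R) (f : R -> \bar R) :
  measurable_fun setT f -> (forall x, 0 <= f x)%E ->
  (\int[normal_prob m s]_x f x = \int[mu]_x (f x * (normal_pdf m s x)%:E))%E.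
Proof.
move=> mf f0.
have mpdf : measurable_fun setT (EFin \o normal_pdf m s).
  by apply/measurable_EFinP; exact: measurable_normal_pdf.
have pdf0 x : (0 <= (normal_pdf m s x)%:E)%E by rewrite lee_fin normal_pdf_ge0.
pose h := nnsfun_approx measurableT mf.
have mh n : measurable_fun [set: R] (fun x => (h n x)%:E).
  by apply/measurable_EFinP.
have cvgh x : EFin \o h ^~ x @ \oo --> f x.
  by apply: cvg_nnsfun_approx => //; exact: I.
have ndh x : {homo (fun n => (h n x)%:E) : a b / (a <= b)%N >-> (a <= b)%E}.
  by move=> a b ab; rewrite lee_fin; exact/lefP/nd_nnsfun_approx.
transitivity (limn (fun n => \int[normal_prob m s]_x (h n x)%:E))%E.
  rewrite -monotone_convergence//.
  - by apply: eq_integral => x _; apply/esym/cvg_lim => //; exact: cvgh.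
  - by move=> n x _; rewrite lee_fin.
transitivity (limn (fun n => \int[mu]_x ((h n x)%:E * (normal_pdf m s x)%:E)))%E;
    last first.
  rewrite -monotone_convergence//.
  - apply: eq_integral => x _; apply/cvg_lim => //.
    apply: cvgeZr => //; exact: cvgh.
  - move=> n; apply: emeasurable_funM => //; exact: mh.
  - by move=> n x _; rewrite mule_ge0// lee_fin.
  - by move=> x _ a b ab; rewrite lee_wpmul2r// ndh.
congr (limn _); apply/funext => n.
have mI r : measurable_fun [set: R] (fun x => (r * \1_(h n @^-1` [set r]) x)%:E).
  by apply/measurable_EFinP; apply: measurable_funM.
under eq_integral do rewrite fimfunE -fsumEFin//.
under [RHS]eq_integral do rewrite fimfunE -fsumEFin//.
rewrite ge0_integral_fsum//; last first.
- by move=> y x _; rewrite nnfun_muleindic_ge0.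
have E0 r x : (0 <= (r * \1_(h n @^-1` [set r]) x)%:E)%E.
  by rewrite nnfun_muleindic_ge0.
under [RHS]eq_integral do rewrite ge0_mule_fsuml//.
rewrite [RHS]ge0_integral_fsum//; last 2 first.
- move=> y; apply: emeasurable_funM => //; exact: mI.
- by move=> y x _; rewrite mule_ge0.
apply: eq_fsbigr => r _.
have mA : measurable (h n @^-1` [set r]) by [].
have [r0|r0] := ltP r 0.
  by rewrite !integral0_eq// => x _; rewrite preimage_nnfun0// indicE in_set0 ?mulr0 ?mul0e.
have mI1 : measurable_fun [set: R] (fun x => (\1_(h n @^-1` [set r]) x)%:E : \bar R).
  by apply/measurable_EFinP.
under eq_integral do rewrite EFinM.
under [RHS]eq_integral do rewrite EFinM -muleA.
rewrite ge0_integralZl//.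
rewrite [RHS]ge0_integralZl//; last 2 first.
- exact: emeasurable_funM.
- by move=> x _; rewrite mule_ge0// lee_fin.
rewrite integral_indic//= setIT.
congr (_ * _)%E; rewrite /normal_prob integral_mkcond; apply: eq_integral => x _.
by rewrite restrict_EFin/= patchE indicE; case: ifP; rewrite ?mul1e ?mul0e.
Qed.

Lemma normal_peakE (s : R) : 0 < s -> normal_peak s = s^-1 * normal_peak 1.
Proof.
move=> s0; rewrite /normal_peak expr1n mul1r -mulrnAr sqrtrM ?sqr_ge0//.
by rewrite sqrtr_sqr gtr0_norm// invfM.
Qed.

Lemma ge0_integral_affine (m b : R) (f : R -> R) : 0 < b -> continuous f ->
  (forall x, 0 <= f x) ->
  (\int[gam]_s (f (m + b * s))%:E = \int[normal_prob m b]_u (f u)%:E)%E.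
Proof.
move=> b0 cf f0; have b0' : b != 0 by rewrite gt_eqF.
have mf : measurable_fun setT f by exact: continuous_measurable_fun.
have mF : measurable_fun setT (fun s => m + b * s).
  by apply: measurable_funD => //; exact: measurable_funM.
pose F := fun s : R^o => m + b * s : R^o.
have F'E : F^`()%classic = cst b.
  apply/funext => x; rewrite /F derive1E deriveD// derive_cst add0r.
  by rewrite deriveM// derive_cst scaler0 addr0 derive_id /= /GRing.scale /= mulr1.
have -> : (\int[gam]_s (f (m + b * s))%:E =
    \int[mu]_s ((f (m + b * s))%:E * (normal_pdf 0 1 s)%:E))%E.
  apply: ge0_integral_normal_prob; last by move=> x; rewrite lee_fin.
  by apply/measurable_EFinP; apply: measurableT_comp.
have -> : (\int[normal_prob m b]_u (f u)%:E =
    \int[mu]_u ((f u)%:E * (normal_pdf m b u)%:E))%E.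
  apply: ge0_integral_normal_prob; last by move=> x; rewrite lee_fin.
  exact/measurable_EFinP.
under [RHS]eq_integral do rewrite -EFinM.
rewrite (@increasing_ge0_integration_by_substitutionT _ F
  (fun x => f x * normal_pdf m b x)).
- apply: eq_integral => x _; rewrite F'E !fctE /= -EFinM; congr EFin.
  rewrite /F !normal_pdfE// normal_peakE// /normal_fun.
  have -> : - (m + b * x - m) ^+ 2 / (b ^+ 2 *+ 2) = - (x - 0) ^+ 2 / (1 ^+ 2 *+ 2).
    by field.
  by rewrite [normal_peak b]normal_peakE// invr1 mul1r; field.
- by move=> x y xy; rewrite /F ltrD2l ltr_pM2l.
- by rewrite F'E => x; exact: cvg_cst.
- by rewrite F'E; exact: is_cvg_cst.
- by rewrite F'E; exact: is_cvg_cst.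
- by move=> x; apply: derivableD => //; exact: derivableM.
- apply: (cvg_comp _ _ _ (cvg_addrl_Ny m)).
  by apply: gt0_cvgMrNy => //; exact: cvg_id.
- apply: (cvg_comp _ _ _ (cvg_addrl m)).
  by apply: gt0_cvgMry => //; exact: cvg_id.
- move=> x; apply: cvgM; first exact: cf.
  exact: continuous_normal_pdf.
- by move=> x; rewrite mulr_ge0// normal_pdf_ge0.
Qed.

Lemma ge0_integral_gaussN (f : R -> \bar R) : measurable_fun setT f ->
  (forall x, 0 <= f x)%E -> (\int[gam]_s f (- s)%R = \int[gam]_s f s)%E.
Proof.
move=> mf f0.
have mfN : measurable_fun setT (fun x : R => f (- x)).
  by apply: (@measurableT_comp _ _ _ _ _ _ f).
rewrite !ge0_integral_normal_prob//.
have mpdf : measurable_fun setT (EFin \o normal_pdf (0 : R) 1).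
  by apply/measurable_EFinP; exact: measurable_normal_pdf.
pose k := fun x : measurableTypeR R => (f x * (normal_pdf 0 1 x)%:E)%E.
have mk : measurable_fun [set: measurableTypeR R] k by exact: emeasurable_funM.
have k0 : {in [set: measurableTypeR R], forall y, (0 <= k y)%E}.
  by move=> x _; rewrite mule_ge0// lee_fin normal_pdf_ge0.
have mN : measurable_fun [set: measurableTypeR R]
  (-%R : measurableTypeR R -> measurableTypeR R) by [].
have E := ge0_integral_pushforward mN mu measurableT mk k0.
rewrite preimage_setT in E.
transitivity (\int[mu]_x (k \o (-%R : measurableTypeR R -> measurableTypeR R)) x)%E.
  apply: eq_integral => x _; rewrite /k /=; congr (_ * _%:E)%E.
  by rewrite !normal_pdfE// /normal_fun !subr0 sqrrN.
rewrite -E; apply: eq_measure_integral => //= A mA _.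
have EN := @lebesgue_measureN R A mA.
by rewrite -EN.
Qed.

(** Bayes' formula for [u = a s + b t] with [s], [t] independent standard: the joint density of
    [(s, u)] is written once as law of [s] times law of [u] given [s], once as law of [u] times law
    of [s] given [u]. *)
Lemma normal_pdf_split (a b c s u : R) : 0 < b -> 0 < c ->
  c ^+ 2 = a ^+ 2 + b ^+ 2 ->
  normal_pdf (a * s) b u * normal_pdf 0 1 s =
  normal_pdf 0 c u * normal_pdf (a * u / c ^+ 2) (b / c) s.
Proof.
move=> b0 c0 c2; have bc0 : 0 < b / c by rewrite divr_gt0.
have [bn cn bcn] : [/\ b != 0, c != 0 & b / c != 0] by rewrite !gt_eqF.
rewrite !normal_pdfE// /normal_fun (normal_peakE b0) (normal_peakE c0).
rewrite (normal_peakE bc0); set p := normal_peak 1.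
have E : expR (- (u - a * s) ^+ 2 / (b ^+ 2 *+ 2)) *
   expR (- (s - 0) ^+ 2 / (1 ^+ 2 *+ 2)) =
   expR (- (u - 0) ^+ 2 / (c ^+ 2 *+ 2)) *
   expR (- (s - a * u / c ^+ 2) ^+ 2 / ((b / c) ^+ 2 *+ 2)).
  rewrite -!expRD; congr expR.
  have a2 : a ^+ 2 = c ^+ 2 - b ^+ 2 by rewrite c2 addrK.
  have -> : - (s - a * u / c ^+ 2) ^+ 2 / ((b / c) ^+ 2 *+ 2) =
    - (s ^+ 2 - 2 * a * u * s / c ^+ 2 + a ^+ 2 * u ^+ 2 / c ^+ 2 / c ^+ 2) *
     c ^+ 2 / (b ^+ 2 *+ 2) by field; rewrite bn cn.
  have -> : (u - a * s) ^+ 2 = u ^+ 2 - 2 * a * u * s + a ^+ 2 * s ^+ 2 by ring.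
  by rewrite a2; field; rewrite bn cn.
transitivity (p * p * b^-1 * (expR (- (u - a * s) ^+ 2 / (b ^+ 2 *+ 2)) *
   expR (- (s - 0) ^+ 2 / (1 ^+ 2 *+ 2)))); first by ring.
rewrite E; move: (expR _) (expR _) => e1 e2.
by rewrite invf_div; field; rewrite bn cn.
Qed.

(* Completing the square against the Gaussian density. *)
Lemma integral_gauss_convolution (a b : R) (f : R -> R) : 0 < a -> 0 < b ->
  continuous f -> (forall x, 0 <= f x) ->
  (\int[gam]_s \int[gam]_t (f (a * s + b * t))%:E =
   \int[gam]_s (f (Num.sqrt (a ^+ 2 + b ^+ 2) * s))%:E)%E.
Proof.
move=> a0 b0 cf f0; set c := Num.sqrt _.
have c2 : c ^+ 2 = a ^+ 2 + b ^+ 2 by rewrite sqr_sqrtr// addr_ge0// sqr_ge0.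
have c0 : 0 < c by rewrite sqrtr_gt0 addr_gt0// exprn_gt0.
have mf : measurable_fun setT f by exact: continuous_measurable_fun.
have [an bn cn] : [/\ a != 0, b != 0 & c != 0] by rewrite !gt_eqF.
under eq_integral do rewrite ge0_integral_affine//.
have -> : (\int[gam]_s (f (c * s))%:E = \int[normal_prob 0 c]_u (f u)%:E)%E.
  by rewrite -(@ge0_integral_affine 0 c f)//; apply: eq_integral => s _; rewrite add0r.
have mp2 : measurable_fun setT (fun p : R * R => normal_pdf (a * p.1) b p.2).
  rewrite (_ : (fun _ => _) = (fun p : R * R => normal_pdf 0 b (p.2 - a * p.1))).
    apply: measurableT_comp; first exact: measurable_normal_pdf.
    by apply: measurable_funB => //; exact: measurable_funM.
  by apply/funext => p; rewrite !normal_pdfE// /normal_fun subr0.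
have H s : (\int[normal_prob (a * s) b]_u (f u)%:E =
   \int[mu]_u (f u * normal_pdf (a * s) b u)%:E)%E.
  by rewrite ge0_integral_normal_prob//; exact/measurable_EFinP.
under eq_integral do rewrite H.
have mk : measurable_fun setT (fun p : R * R =>
    (f p.2 * normal_pdf (a * p.1) b p.2 * normal_pdf 0 1 p.1)%:E).
  apply/measurable_EFinP; apply: measurable_funM; first apply: measurable_funM => //.
    exact: measurableT_comp.
  by apply: measurableT_comp => //; exact: measurable_normal_pdf.
have mk1 s : measurable_fun setT (fun u => f u * normal_pdf (a * s) b u).
  by apply: measurable_funM => //; exact: measurable_normal_pdf.
have mk1' s : measurable_fun [set: R] (fun u => (f u * normal_pdf (a * s) b u)%:E).
  by apply/measurable_EFinP; exact: mk1.
rewrite (@ge0_integral_normal_prob 0 1)//; last 2 first.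
- apply: (@measurable_fun_fubini_tonelli_F _ _ _ _ _ mu
    (fun p : R * R => (f p.2 * normal_pdf (a * p.1) b p.2)%:E)).
  + by apply/measurable_EFinP; apply: measurable_funM => //; exact: measurableT_comp.
  + by move=> x; rewrite lee_fin mulr_ge0// normal_pdf_ge0.
- by move=> s; apply: integral_ge0 => u _; rewrite lee_fin mulr_ge0// normal_pdf_ge0.
transitivity (\int[mu]_s \int[mu]_u
   (f u * normal_pdf (a * s) b u * normal_pdf 0 1 s)%:E)%E.
  apply: eq_integral => s _; rewrite -ge0_integralZr//.
  - exact: mk1'.
  - by move=> u _; rewrite lee_fin mulr_ge0// normal_pdf_ge0.
  - by rewrite lee_fin normal_pdf_ge0.
(* After the exchange of integrals the inner one runs over the conditional density of [s] given [u],
   which has total mass 1. *)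
rewrite (@fubini_tonelli _ _ _ _ _ mu mu (fun p : R * R =>
    (f p.2 * normal_pdf (a * p.1) b p.2 * normal_pdf 0 1 p.1)%:E))//; last first.
  by move=> p; rewrite lee_fin !mulr_ge0// normal_pdf_ge0.
rewrite ge0_integral_normal_prob//; last exact/measurable_EFinP.
apply: eq_integral => u _ /=.
transitivity (\int[mu]_s ((f u * normal_pdf 0 c u)%:E *
    (normal_pdf (a * u / c ^+ 2) (b / c) s)%:E))%E.
  apply: eq_integral => s _; rewrite -EFinM /=; congr EFin.
  by have := normal_pdf_split s u b0 c0 c2; rewrite -!mulrA => ->.
rewrite ge0_integralZl//; last 3 first.
- by apply/measurable_EFinP; exact: measurable_normal_pdf.
- by move=> x _; rewrite lee_fin normal_pdf_ge0.
- by rewrite lee_fin mulr_ge0// normal_pdf_ge0.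
by rewrite integral_normal_pdf mule1.
Qed.

(** The moment generating function of a squared standard Gaussian: the tilt by [exp (l s^2)] turns
    the density into [k^-1] times the normal density of standard deviation [k^-1], where
    [k = sqrt (1 - 2 l)]. *)
Lemma integral_expR_sqr (l : R) : l < 2^-1 ->
  (\int[gam]_s (expR (l * s ^+ 2))%:E = ((Num.sqrt (1 - 2 * l))^-1)%:E)%E.
Proof.
move=> l2; have k0 : 0 < 1 - 2 * l by lra.
set k := Num.sqrt _; have kp : 0 < k by rewrite sqrtr_gt0.
have kn : k != 0 by rewrite gt_eqF.
have kV : 0 < k^-1 by rewrite invr_gt0.
have kVn : k^-1 != 0 by rewrite gt_eqF.
have k2 : k ^+ 2 = 1 - 2 * l by rewrite sqr_sqrtr// ltW.
rewrite ge0_integral_normal_prob//; last first.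
  apply/measurable_EFinP; apply: measurableT_comp => //.
  by apply: measurable_funM => //; exact: measurable_funX.
transitivity (\int[mu]_s ((k^-1)%:E * (normal_pdf 0 k^-1 s)%:E))%E.
  apply: eq_integral => s _; rewrite -!EFinM; congr EFin.
  rewrite !normal_pdfE// (normal_peakE kV) /normal_fun invrK.
  have -> : - (s - 0) ^+ 2 / (k^-1 ^+ 2 *+ 2) =
     l * s ^+ 2 + - (s - 0) ^+ 2 / (1 ^+ 2 *+ 2).
    transitivity (- (s ^+ 2) * k ^+ 2 / 2); first by field.
    by rewrite k2; field.
  by rewrite expRD; field.
rewrite ge0_integralZl//; last 3 first.
- by apply/measurable_EFinP; exact: measurable_normal_pdf.
- by move=> x _; rewrite lee_fin normal_pdf_ge0.
- by rewrite lee_fin ltW.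
by rewrite integral_normal_pdf mule1.
Qed.

End StandardGaussian.

(** * Real-valued Gaussian means: integrability, symmetry, Fubini *)

Section GaussMean.
Variable R : realType.
Local Notation gam := (@normal_prob R 0 1).

Definition gauss_integrable (g : R -> R) := gam.-integrable [set: R] (EFin \o g).

Definition gauss_mean (g : R -> R) : R := \int[gam]_s g s.

Lemma gauss_integrable_measurable (g : R -> R) :
  gauss_integrable g -> measurable_fun [set: R] g.
Proof. by move=> /measurable_int/measurable_EFinP. Qed.

Lemma gauss_integrableP (g : R -> R) : measurable_fun [set: R] g ->
  (\int[gam]_s `|(g s)%:E| < +oo)%E -> gauss_integrable g.
Proof. by move=> mg gy; apply/integrableP; split => //; apply/measurable_EFinP. Qed.

Lemma gauss_integrable_le (f g : R -> R) : measurable_fun [set: R] f ->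
  gauss_integrable g -> (forall s, `|f s| <= g s) -> gauss_integrable f.
Proof.
move=> mf ig fg; apply: (le_integrable _ _ _ ig) => //.
- by apply/measurable_EFinP.
- move=> s _; rewrite /= lee_fin (le_trans (fg s))// ger0_norm//.
  exact: le_trans (fg s).
Qed.

Lemma gauss_integrable_cst (c : R) : gauss_integrable (fun=> c).
Proof. exact: finite_measure_integrable_cst. Qed.

Lemma gauss_integrable_bounded (g : R -> R) (B : R) :
  measurable_fun [set: R] g -> (forall s, `|g s| <= B) -> gauss_integrable g.
Proof.
by move=> mg gB; apply: (gauss_integrable_le mg (gauss_integrable_cst B)).
Qed.

Lemma gauss_integrableD (f g : R -> R) : gauss_integrable f ->
  gauss_integrable g -> gauss_integrable (fun s => f s + g s).
Proof. by move=> fi gi; apply: (integrableD _ fi gi). Qed.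

Lemma gauss_integrableZ (k : R) (f : R -> R) : gauss_integrable f ->
  gauss_integrable (fun s => k * f s).
Proof. by move=> fi; apply: (integrableZl _ k fi). Qed.

Lemma EFin_gauss_mean (g : R -> R) : gauss_integrable g ->
  (gauss_mean g)%:E = (\int[gam]_s (g s)%:E)%E.
Proof. by move=> gi; rewrite /gauss_mean fineK//; exact: integrable_fin_num. Qed.

Lemma gauss_mean_cst (c : R) : gauss_mean (fun=> c) = c.
Proof.
by rewrite /gauss_mean /Rintegral integral_cst// [X in (_ * X)%E](@probability_setT _ _ _ gam) mule1.
Qed.

Lemma gauss_meanD (f g : R -> R) : gauss_integrable f -> gauss_integrable g ->
  gauss_mean (fun s => f s + g s) = gauss_mean f + gauss_mean g.
Proof. by move=> fi gi; apply: RintegralD. Qed.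

Lemma gauss_meanB (f g : R -> R) : gauss_integrable f -> gauss_integrable g ->
  gauss_mean (fun s => f s - g s) = gauss_mean f - gauss_mean g.
Proof. by move=> fi gi; apply: RintegralB. Qed.

Lemma gauss_meanZ (k : R) (f : R -> R) : gauss_integrable f ->
  gauss_mean (fun s => k * f s) = k * gauss_mean f.
Proof. by move=> fi; apply: RintegralZl. Qed.

Lemma gauss_mean_le (f g : R -> R) : gauss_integrable f -> gauss_integrable g ->
  (forall s, f s <= g s) -> gauss_mean f <= gauss_mean g.
Proof. by move=> fi gi fg; apply: le_Rintegral. Qed.

Lemma gauss_mean_norm_le (f g : R -> R) : gauss_integrable f ->
  gauss_integrable g -> (forall s, `|f s| <= g s) ->
  `|gauss_mean f| <= gauss_mean g.
Proof.
move=> fi gi fg; rewrite ler_norml; apply/andP; split.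
  rewrite -[- _]mulN1r -gauss_meanZ//; apply: gauss_mean_le => //.
    exact: gauss_integrableZ.
  by move=> s; have := fg s; rewrite ler_norml => /andP[]; rewrite mulN1r.
by apply: gauss_mean_le => // s; exact: le_trans (ler_norm _) (fg s).
Qed.

Lemma gauss_mean_expR_sqr (l : R) : l < 2^-1 ->
  gauss_integrable (fun s => expR (l * s ^+ 2)) /\
  gauss_mean (fun s => expR (l * s ^+ 2)) = (Num.sqrt (1 - 2 * l))^-1.
Proof.
move=> l2; split; last by rewrite /gauss_mean /Rintegral integral_expR_sqr.
apply: gauss_integrableP.
  by apply: measurableT_comp => //; apply: measurable_funM.
under eq_integral do rewrite gee0_abs ?lee_fin ?expR_ge0//.
by rewrite integral_expR_sqr// ltry.
Qed.

(** Squaring [exp (x / 8) >= x / 8] at [x = s^2] gives [s^4 <= 64 exp (s^2 / 4)], which is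
    integrable. The lower moments are then compared with [1 + s^4]. *)
Lemma gauss_integrable_pow4 : gauss_integrable (fun s => 1 + s ^+ 4).
Proof.
have [ie _] := @gauss_mean_expR_sqr 4^-1 ltac:(lra).
apply: (gauss_integrable_le _ (gauss_integrableD (gauss_integrable_cst 1)
  (gauss_integrableZ 64 ie))).
  by apply: measurable_funD => //; exact: measurable_funX.
move=> s; have s4 : 0 <= s ^+ 4 by rewrite exprn_even_ge0.
rewrite ger0_norm ?addr_ge0// lerD2l.
have -> : 4^-1 * s ^+ 2 = s ^+ 2 / 8 + s ^+ 2 / 8 by field.
rewrite expRD; have := expR_ge1Dx (s ^+ 2 / 8).
have s2 : 0 <= s ^+ 2 by rewrite sqr_ge0.
have -> : s ^+ 4 = s ^+ 2 * s ^+ 2 by ring.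
move: s2; move: (s ^+ 2) => x x0; move: (expR _) => e ex.
have : x / 8 <= e by lra.
by move=> xe; have := ler_pM (divr_ge0 x0 _) (divr_ge0 x0 _) xe xe; nra.
Qed.

Lemma gauss_integrable_poly (g : R -> R) : measurable_fun [set: R] g ->
  (forall s, `|g s| <= 1 + s ^+ 4) -> gauss_integrable g.
Proof. by move=> mg gs; exact: (gauss_integrable_le mg gauss_integrable_pow4). Qed.

Lemma gauss_integrable_id : gauss_integrable (fun s => s).
Proof.
apply: gauss_integrable_poly => // s.
have -> : s ^+ 4 = `|s| ^+ 4 by rewrite -normrX ger0_norm// exprn_even_ge0.
by have := sqr_ge0 (`|s| ^+ 2 - 2^-1); have := sqr_ge0 (`|s| - 2^-1); nra.
Qed.

Lemma gauss_integrable_sqr : gauss_integrable (fun s => s ^+ 2).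
Proof.
apply: gauss_integrable_poly => [|s]; first exact: measurable_funX.
by rewrite ger0_norm ?sqr_ge0//; nra.
Qed.

Lemma gauss_integrable_cube : gauss_integrable (fun s => `|s| ^+ 3).
Proof.
apply: gauss_integrable_poly => [|s].
  by apply: measurable_funX; exact: normr_measurable.
rewrite ger0_norm ?exprn_ge0//.
have -> : s ^+ 4 = `|s| ^+ 4 by rewrite -normrX ger0_norm// exprn_even_ge0.
by have := normr_ge0 s; move: `|s| => t t0; nra.
Qed.

Lemma gauss_meanN (g : R -> R) : measurable_fun [set: R] g ->
  gauss_mean (fun s => g (- s)) = gauss_mean g.
Proof.
move=> mg; rewrite /gauss_mean /Rintegral; congr fine.
have mg' : measurable_fun [set: R] (EFin \o g) by apply/measurable_EFinP.
rewrite integralE [RHS]integralE; congr (_ - _)%E.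
  have := ge0_integral_gaussN (measurable_funepos mg') (funepos_ge0 _).
  by move=> <-; rewrite funepos.unlock.
have := ge0_integral_gaussN (measurable_funeneg mg') (funeneg_ge0 _).
by move=> <-; rewrite funeneg.unlock.
Qed.

Lemma gauss_mean_id : gauss_mean (fun s => s) = 0.
Proof.
have := @gauss_meanN (fun s => s) (@measurable_id _ _ _).
have -> : (fun s : R => - s) = (fun s => -1 * s) by apply/funext => s; rewrite mulN1r.
rewrite gauss_meanZ; last exact: gauss_integrable_id.
by move=> h; lra.
Qed.

(** Tonelli's theorem speaks of nonnegative functions; adding the bound [B] reduces the bounded case
    to it. The same shift serves for Fubini and for the convolution identity below. *)
Lemma gauss_mean_measurable d (T : measurableType d) (G : T * R -> R) (B : R) :
  measurable_fun [set: T * R] G -> (forall p, `|G p| <= B) ->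
  measurable_fun [set: T] (fun w => gauss_mean (fun t => G (w, t))).
Proof.
move=> mG GB.
have mGw w : measurable_fun [set: R] (fun t => G (w, t)).
  exact: measurableT_comp.
rewrite (_ : (fun w => _) = (fun w => fine (\int[gam]_t (G (w, t) + B)%:E)%E - B)).
  apply: measurable_funB => //; apply: measurableT_comp => //.
  apply: (@measurable_fun_fubini_tonelli_F _ _ _ _ _ gam
    (fun p : T * R => (G p + B)%:E)).
  - by apply/measurable_EFinP; apply: measurable_funD.
  - move=> p; rewrite lee_fin; have := GB p; rewrite ler_norml => /andP[]; lra.
apply/funext => w; rewrite -[fine _]/(gauss_mean (fun t => G (w, t) + B)).
rewrite gauss_meanD ?gauss_mean_cst ?addrK//.
- exact: gauss_integrable_bounded (mGw w) (fun t => GB (w, t)).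
- exact: gauss_integrable_cst.
Qed.

Lemma gauss_mean_fubini (G : R * R -> R) (B : R) :
  measurable_fun [set: R * R] G -> (forall p, `|G p| <= B) ->
  gauss_mean (fun s => gauss_mean (fun t => G (s, t))) =
  gauss_mean (fun t => gauss_mean (fun s => G (s, t))).
Proof.
move=> mG GB; pose H p := G p + B.
have H0 p : 0 <= H p.
  by rewrite /H; have := GB p; rewrite ler_norml => /andP[]; lra.
have mH : measurable_fun [set: R * R] H by exact: measurable_funD.
have i1 s : gauss_integrable (fun t => G (s, t)).
  by apply: (gauss_integrable_bounded (B := B)) => //; exact: measurableT_comp.
have i2 t : gauss_integrable (fun s => G (s, t)).
  by apply: (gauss_integrable_bounded (B := B)) => //; exact: measurableT_comp.
have bd (g : R -> R) : gauss_integrable g -> (forall s, `|g s| <= B) ->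
    `|gauss_mean g| <= B.
  move=> ig gB; rewrite -[leRHS]gauss_mean_cst.
  exact: gauss_mean_norm_le ig (gauss_integrable_cst B) gB.
have iG1 : gauss_integrable (fun s => gauss_mean (fun t => G (s, t))).
  apply: (gauss_integrable_bounded (B := B)); first exact: gauss_mean_measurable mG GB.
  by move=> s; exact: bd.
have iG2 : gauss_integrable (fun t => gauss_mean (fun s => G (s, t))).
  apply: (gauss_integrable_bounded (B := B)); last by move=> s; exact: bd.
  apply: (@gauss_mean_measurable _ _ (fun p => G (p.2, p.1)) B) => //.
  apply: measurableT_comp => //; exact: measurable_swap.
apply: (addIr B).
have gB := gauss_integrable_cst B.
transitivity (gauss_mean (fun s => gauss_mean (fun t => H (s, t)))).
  rewrite -[X in _ + X](gauss_mean_cst B) -gauss_meanD//.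
  by congr gauss_mean; apply/funext => s; rewrite gauss_meanD// gauss_mean_cst.
transitivity (gauss_mean (fun t => gauss_mean (fun s => H (s, t)))); last first.
  rewrite -[X in _ = _ + X](gauss_mean_cst B) -gauss_meanD//.
  by congr gauss_mean; apply/funext => s; rewrite gauss_meanD// gauss_mean_cst.
rewrite [LHS]/gauss_mean [RHS]/gauss_mean /Rintegral; congr fine.
have h1 s : gauss_integrable (fun t => H (s, t)) by exact: gauss_integrableD.
have h2 t : gauss_integrable (fun s => H (s, t)) by exact: gauss_integrableD.
under eq_integral do rewrite EFin_gauss_mean//.
under [RHS]eq_integral do rewrite EFin_gauss_mean//.
apply: (@fubini_tonelli _ _ _ _ _ gam gam (fun p => (H p)%:E)).
- by apply/measurable_EFinP.
- by move=> p; rewrite lee_fin.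
Qed.

Lemma gauss_mean_convolution (a b B : R) (f : R -> R) : 0 < a -> 0 < b ->
  continuous f -> (forall x, `|f x| <= B) ->
  gauss_mean (fun s => gauss_mean (fun t => f (a * s + b * t))) =
  gauss_mean (fun s => f (Num.sqrt (a ^+ 2 + b ^+ 2) * s)).
Proof.
move=> a0 b0 cf fB; set c := Num.sqrt _.
have mf : measurable_fun [set: R] f by exact: continuous_measurable_fun.
pose H x := f x + B.
have H0 x : 0 <= H x.
  by rewrite /H; have := fB x; rewrite ler_norml => /andP[]; lra.
have cH : continuous H by move=> x; apply: cvgD; [exact: cf|exact: cvg_cst].
have mab : measurable_fun [set: R * R] (fun p : R * R => f (a * p.1 + b * p.2)).
  by apply: measurableT_comp => //; apply: measurable_funD; exact: measurable_funM.
have i1 s : gauss_integrable (fun t => f (a * s + b * t)).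
  apply: (gauss_integrable_bounded (B := B)) => //; apply: measurableT_comp => //.
  by apply: measurable_funD => //; exact: measurable_funM.
have i2 : gauss_integrable (fun s => f (c * s)).
  apply: (gauss_integrable_bounded (B := B)) => //.
  by apply: measurableT_comp => //; exact: measurable_funM.
have gB := gauss_integrable_cst B.
have i3 : gauss_integrable (fun s => gauss_mean (fun t => f (a * s + b * t))).
  apply: (gauss_integrable_bounded (B := B)).
    exact: (gauss_mean_measurable (B := B) mab).
  move=> s; rewrite -[leRHS]gauss_mean_cst.
  exact: gauss_mean_norm_le.
apply: (addIr B).
transitivity (gauss_mean (fun s => gauss_mean (fun t => H (a * s + b * t)))).
  rewrite -[X in _ + X](gauss_mean_cst B) -gauss_meanD//.
  by congr gauss_mean; apply/funext => s; rewrite gauss_meanD// gauss_mean_cst.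
transitivity (gauss_mean (fun s => H (c * s))); last first.
  by rewrite gauss_meanD// gauss_mean_cst.
rewrite [LHS]/gauss_mean [RHS]/gauss_mean /Rintegral; congr fine.
have h1 s : gauss_integrable (fun t => H (a * s + b * t)) by exact: gauss_integrableD.
under eq_integral do rewrite EFin_gauss_mean//.
exact: integral_gauss_convolution.
Qed.

End GaussMean.

(** * Gaussian averaging operators along directions *)

Section GaussianAveraging.
Variables (R : realType) (I : finType).
Implicit Types (x y v w : I -> R) (f g : (I -> R) -> R) (s t : R).

(** The l1 norm is chosen so that coordinatewise bounds on gradients and Hessians sum up without
    dimensional constants. *)
Definition norm1 x : R := \sum_i `|x i|.

Definition ray x v s : I -> R := fun i => x i + s * v i.

Definition scalev (a : R) v : I -> R := fun i => a * v i.

(* Measurability is stated through compositions, so that no sigma-algebra on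
   [I -> R] has to be chosen. *)
Definition comp_measurable f := forall d (T : measurableType d) (F : T -> I -> R),
  (forall i, measurable_fun [set: T] (fun o => F o i)) ->
  measurable_fun [set: T] (fun o => f (F o)).

(** The class of test functions, closed under sums, products and averaging: boundedness makes all
    means finite and Fubini applicable, the Lipschitz bound gives the continuity along lines that
    the convolution identity asks for. *)
Definition bounded_lipschitz f :=
  [/\ exists B, forall x, `|f x| <= B,
      exists2 L, 0 <= L & forall x y, `|f x - f y| <= L * norm1 (fun i => x i - y i)
    & comp_measurable f].

Definition gavg v f x := gauss_mean (fun s => f (ray x v s)).

(** The mean of [f] at [x] shifted by the Gaussian vector [sum_v s_v v], with one independent
    standard [s_v] for each entry of [vs]. Any finite Gaussian vector is of this form. *)
Definition gavgs vs f := foldr gavg f vs.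

Lemma norm1_ge0 x : 0 <= norm1 x.
Proof. by apply: sumr_ge0 => i _. Qed.

Lemma norm1_ray v s t x :
  norm1 (fun i => ray x v s i - ray x v t i) = `|s - t| * norm1 v.
Proof.
rewrite /norm1 mulr_sumr; apply: eq_bigr => i _; rewrite -normrM.
by congr `|_|; rewrite /ray; ring.
Qed.

Lemma norm1_scalev a v : norm1 (scalev a v) = `|a| * norm1 v.
Proof. by rewrite /norm1 mulr_sumr; apply: eq_bigr => i _; rewrite normrM. Qed.

Lemma ray_ray x v w s t : ray (ray x v s) w t = ray (ray x w t) v s.
Proof. by apply/funext => i; rewrite /ray addrAC. Qed.

Lemma measurable_ray f x v : comp_measurable f ->
  measurable_fun [set: R] (fun s => f (ray x v s)).
Proof.
move=> mf; apply: (mf _ R (fun s => ray x v s)) => i.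
by apply: measurable_funD => //; exact: measurable_funM.
Qed.

Lemma integrable_ray f x v : bounded_lipschitz f ->
  gauss_integrable (fun s => f (ray x v s)).
Proof.
case=> [[B fB] _ mf]; apply: (gauss_integrable_bounded (B := B)) => //.
exact: measurable_ray.
Qed.

Lemma lipschitz_continuous (h : R -> R) (K : R) :
  (forall s t, `|h s - h t| <= K * `|s - t|) -> continuous h.
Proof.
move=> hK x; apply/cvgrPdist_lt => e e0; near=> y.
have K0 : 0 < `|K| + 1 by rewrite ltr_pwDr.
apply: (le_lt_trans (hK _ _)); apply: (@le_lt_trans _ _ ((`|K| + 1) * `|x - y|)).
  by rewrite ler_wpM2r// (le_trans (ler_norm K))// lerDl.
rewrite -ltr_pdivlMl// mulrC; near: y.
by exists (e / (`|K| + 1)); [rewrite /= divr_gt0|].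
Unshelve. all: by end_near. Qed.

Lemma continuous_ray f x v : bounded_lipschitz f -> continuous (fun s => f (ray x v s)).
Proof.
case=> [_ [L L0 fL] _]; apply: (@lipschitz_continuous _ (L * norm1 v)) => s t.
by rewrite (le_trans (fL _ _))// norm1_ray mulrCA mulrC.
Qed.

Lemma gavg_norm_le f v x B : bounded_lipschitz f -> (forall y, `|f y| <= B) ->
  `|gavg v f x| <= B.
Proof.
move=> nf fB; rewrite -[leRHS](gauss_mean_cst B).
exact: gauss_mean_norm_le (integrable_ray x v nf) (gauss_integrable_cst B) _.
Qed.

Lemma bounded_lipschitz_gavg v f : bounded_lipschitz f -> bounded_lipschitz (gavg v f).
Proof.
move=> nf; have [[B fB] [L L0 fL] mf] := nf; split.
- by exists B => x; exact: gavg_norm_le.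
- exists L => // x y; rewrite /gavg -gauss_meanB; [|exact: integrable_ray..].
  rewrite -[leRHS]gauss_mean_cst; apply: gauss_mean_norm_le.
  + rewrite (_ : (fun s => _) = (fun s => f (ray x v s) + -1 * f (ray y v s))).
      by apply: gauss_integrableD; [|apply: gauss_integrableZ]; exact: integrable_ray.
    by apply/funext => s; rewrite mulN1r.
  + exact: gauss_integrable_cst.
  + move=> s; rewrite (le_trans (fL _ _))// le_eqVlt; apply/orP; left; apply/eqP.
    by congr (_ * _); apply: eq_bigr => i _; congr `|_|; rewrite /ray; ring.
- move=> d T F mF; rewrite /gavg.
  apply: (gauss_mean_measurable (B := B) (G := fun p => f (ray (F p.1) v p.2))) => //.
  apply: (mf _ (T * R)%type (fun p => ray (F p.1) v p.2)) => i.
  apply: measurable_funD; last exact: measurable_funM.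
  by apply: (measurableT_comp (mF i)).
Qed.

Lemma bounded_lipschitz_gavgs vs f : bounded_lipschitz f -> bounded_lipschitz (gavgs vs f).
Proof. by move=> nf; elim: vs => //= v vs; exact: bounded_lipschitz_gavg. Qed.

Lemma gavg_le f g v x : bounded_lipschitz f -> bounded_lipschitz g ->
  (forall y, f y <= g y) -> gavg v f x <= gavg v g x.
Proof. by move=> nf ng fg; apply: gauss_mean_le => //; exact: integrable_ray. Qed.

Lemma gavgs_le vs f g x : bounded_lipschitz f -> bounded_lipschitz g ->
  (forall y, f y <= g y) -> gavgs vs f x <= gavgs vs g x.
Proof.
move=> nf ng fg; elim: vs x => //= v vs IH x.
by apply: gavg_le => //; exact: bounded_lipschitz_gavgs.
Qed.

Lemma gavg_cst (c : R) v x : gavg v (fun=> c) x = c.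
Proof. exact: gauss_mean_cst. Qed.

Lemma bounded_lipschitz_cst (c : R) : bounded_lipschitz (fun=> c).
Proof.
split; first by exists `|c|.
  by exists 0 => // x y; rewrite subrr normr0 mul0r.
by move=> d T F _; exact: measurable_cst.
Qed.

Lemma bounded_lipschitzD f g : bounded_lipschitz f -> bounded_lipschitz g ->
  bounded_lipschitz (fun x => f x + g x).
Proof.
move=> [[B fB] [L L0 fL] mf] [[B' gB] [L' L0' gL] mg]; split.
- by exists (B + B') => x; rewrite (le_trans (ler_normD _ _))// lerD.
- exists (L + L'); first exact: addr_ge0.
  move=> x y; rewrite mulrDl; apply: le_trans (lerD (fL x y) (gL x y)).
  by apply: le_trans (ler_normD _ _); rewrite opprD addrACA.
- by move=> d T F mF; apply: measurable_funD; [exact: mf|exact: mg].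
Qed.

Lemma bounded_lipschitzM f g : bounded_lipschitz f -> bounded_lipschitz g ->
  bounded_lipschitz (fun x => f x * g x).
Proof.
move=> [[B fB] [L L0 fL] mf] [[B' gB] [L' L0' gL] mg].
have B0 : 0 <= B by exact: le_trans (fB (fun=> 0)).
have B0' : 0 <= B' by exact: le_trans (gB (fun=> 0)).
split.
- by exists (B * B') => x; rewrite normrM ler_pM.
- exists (L * B' + B * L'); first by rewrite addr_ge0// mulr_ge0.
  move=> x y.
  have -> : f x * g x - f y * g y = (f x - f y) * g x + f y * (g x - g y) by ring.
  rewrite (le_trans (ler_normD _ _))// !normrM mulrDl; apply: lerD.
    by rewrite mulrAC; apply: ler_pM.
  by rewrite -mulrA; apply: ler_pM.
- by move=> d T F mF; apply: measurable_funM; [exact: mf|exact: mg].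
Qed.

Lemma bounded_lipschitzZ (k : R) f : bounded_lipschitz f ->
  bounded_lipschitz (fun x => k * f x).
Proof. by move=> nf; apply: bounded_lipschitzM => //; exact: bounded_lipschitz_cst. Qed.

Lemma gavgD v f g x : bounded_lipschitz f -> bounded_lipschitz g ->
  gavg v (fun x => f x + g x) x = gavg v f x + gavg v g x.
Proof. by move=> nf ng; apply: gauss_meanD; exact: integrable_ray. Qed.

Lemma gavgsD vs f g x : bounded_lipschitz f -> bounded_lipschitz g ->
  gavgs vs (fun x => f x + g x) x = gavgs vs f x + gavgs vs g x.
Proof.
move=> nf ng; elim: vs x => //= v vs IH x; rewrite -gavgD; last 2 first.
- exact: bounded_lipschitz_gavgs.
- exact: bounded_lipschitz_gavgs.
by congr gavg; apply/funext.
Qed.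

Lemma gavgsZ vs k f x : bounded_lipschitz f ->
  gavgs vs (fun x => k * f x) x = k * gavgs vs f x.
Proof.
move=> nf; elim: vs x => //= v vs IH x.
rewrite /gavg -gauss_meanZ; last exact/integrable_ray/bounded_lipschitz_gavgs.
by congr gauss_mean; apply/funext => s; exact: IH.
Qed.

Lemma gavgs_cst vs (c : R) x : gavgs vs (fun=> c) x = c.
Proof.
elim: vs x => //= v vs IH x; rewrite -[RHS](gauss_mean_cst c).
by congr gauss_mean; apply/funext => s; exact: IH.
Qed.

Lemma gavgC v w f : bounded_lipschitz f -> gavg v (gavg w f) = gavg w (gavg v f).
Proof.
move=> [[B fB] _ mf]; apply/funext => x; rewrite /gavg.
have mG : measurable_fun [set: R * R] (fun p : R * R => f (ray (ray x v p.1) w p.2)).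
  apply: (mf _ (R * R)%type (fun p => ray (ray x v p.1) w p.2)) => i.
  apply: measurable_funD; last exact: measurable_funM.
  by apply: measurable_funD => //; exact: measurable_funM.
apply: etrans (gauss_mean_fubini mG (fun p => fB _)) _.
by congr gauss_mean; apply/funext => t; congr gauss_mean; apply/funext => s; rewrite ray_ray.
Qed.

Lemma gavg_gavgsC v vs f : bounded_lipschitz f ->
  gavg v (gavgs vs f) = gavgs vs (gavg v f).
Proof.
move=> nf; elim: vs => //= w vs IH; rewrite gavgC ?IH//.
exact: bounded_lipschitz_gavgs.
Qed.

(** Stability of the Gaussian law: independent shifts along the same [v] add their variances. *)
Lemma gavg_scale_comp a b v f : 0 < a -> 0 < b -> bounded_lipschitz f ->
  gavg (scalev a v) (gavg (scalev b v) f) = gavg (scalev (Num.sqrt (a ^+ 2 + b ^+ 2)) v) f.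
Proof.
move=> a0 b0 nf; have [[B fB] _ _] := nf; apply/funext => x; rewrite /gavg.
have E k s : ray x (scalev k v) s = ray x v (k * s).
  by apply/funext => i; rewrite /ray /scalev; ring.
have E2 s t : ray (ray x (scalev a v) s) (scalev b v) t = ray x v (a * s + b * t).
  by apply/funext => i; rewrite /ray /scalev; ring.
transitivity (gauss_mean (fun s => f (ray x v (Num.sqrt (a ^+ 2 + b ^+ 2) * s))));
  last by congr gauss_mean; apply/funext => s; rewrite E.
have cont : continuous (fun s => f (ray x v s)) by exact: continuous_ray.
have conv := gauss_mean_convolution a0 b0 cont (fun s => fB (ray x v s)).
apply: (etrans _ conv).
by congr gauss_mean; apply/funext => s; congr gauss_mean; apply/funext => t; rewrite E2.
Qed.

Lemma gavgs_scale_comp a b vs f : 0 < a -> 0 < b -> bounded_lipschitz f ->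
  gavgs (map (scalev a) vs) (gavgs (map (scalev b) vs) f) =
  gavgs (map (scalev (Num.sqrt (a ^+ 2 + b ^+ 2))) vs) f.
Proof.
move=> a0 b0 nf; elim: vs => //= v vs IH.
rewrite -gavg_gavgsC; last exact: bounded_lipschitz_gavgs.
rewrite gavg_scale_comp//; last first.
  by do 2 apply: bounded_lipschitz_gavgs.
by rewrite IH.
Qed.

(** Infinite divisibility, read backwards: with [h = 1 / sqrt N.+1] the iterate is the full average
    over [vs], so that average splits into arbitrarily small steps. *)
Lemma iter_gavgs h vs f N : 0 < h -> bounded_lipschitz f ->
  iter N.+1 (gavgs (map (scalev h) vs)) f =
  gavgs (map (scalev (Num.sqrt N.+1%:R * h)) vs) f.
Proof.
move=> h0 nf; elim: N => [|N IH]; first by rewrite sqrtr1 mul1r.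
rewrite iterS IH gavgs_scale_comp//; last by rewrite mulr_gt0// sqrtr_gt0 ltr0Sn.
have -> : h ^+ 2 + (Num.sqrt N.+1%:R * h) ^+ 2 = N.+2%:R * h ^+ 2.
  by rewrite exprMn sqr_sqrtr// -[N.+2%:R]natr1; ring.
by rewrite sqrtrM// sqrtr_sqr gtr0_norm.
Qed.

End GaussianAveraging.

(** * Slepian's inequality for smooth functions *)

Section Slepian.
Variables (R : realType) (I : finType).
Implicit Types (x y v w e : I -> R) (f g : (I -> R) -> R).
Implicit Types (D : I -> (I -> R) -> R) (H : I * I -> (I -> R) -> R) (C h : R).

Definition translate x e : I -> R := fun i => x i + e i.

Lemma ray_translate x e v s : ray (translate x e) v s = translate (ray x v s) e.
Proof. by apply/funext => i; rewrite /ray /translate addrAC. Qed.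

Lemma rayE x v s : ray x v s = translate x (scalev s v).
Proof. by []. Qed.

Lemma bounded_lipschitz_translate f e : bounded_lipschitz f ->
  bounded_lipschitz (fun x => f (translate x e)).
Proof.
case=> [[B fB] [L L0 fL] mf]; split; first by exists B.
  exists L => // x y; rewrite (le_trans (fL _ _))// le_eqVlt; apply/orP; left.
  apply/eqP; congr (_ * _); apply: eq_bigr => i _; congr `|_|.
  by rewrite /translate; ring.
move=> d T F mF; apply: (mf _ T (fun o => translate (F o) e)) => i.
exact: measurable_funD.
Qed.

Lemma gavg_translate v f e x :
  gavg v (fun x => f (translate x e)) x = gavg v f (translate x e).
Proof. by congr gauss_mean; apply/funext => s; rewrite ray_translate. Qed.

Lemma bounded_lipschitz_sum (J : finType) (c : J -> R) (F : J -> (I -> R) -> R) :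
  (forall j, bounded_lipschitz (F j)) ->
  bounded_lipschitz (fun x => \sum_j c j * F j x).
Proof.
move=> nF; elim: (index_enum J) => [|j r IH].
  by under eq_fun do rewrite big_nil; exact: bounded_lipschitz_cst.
under eq_fun do rewrite big_cons.
by apply: bounded_lipschitzD => //; exact: bounded_lipschitzZ.
Qed.

Lemma gavgZ v k f x : bounded_lipschitz f ->
  gavg v (fun x => k * f x) x = k * gavg v f x.
Proof. exact: (@gavgsZ R I [:: v]). Qed.

Lemma gavg_sum (J : finType) (c : J -> R) (F : J -> (I -> R) -> R) v x :
  (forall j, bounded_lipschitz (F j)) ->
  gavg v (fun x => \sum_j c j * F j x) x = \sum_j c j * gavg v (F j) x.
Proof.
move=> nF.
suff [] : bounded_lipschitz (fun x => \sum_j c j * F j x) /\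
   gavg v (fun x => \sum_j c j * F j x) x = \sum_j c j * gavg v (F j) x by [].
elim: (index_enum J) => [|j r [IH1 IH2]].
  under eq_fun do rewrite big_nil; rewrite big_nil.
  by split; [exact: bounded_lipschitz_cst|exact: gavg_cst].
under eq_fun do rewrite big_cons; rewrite big_cons.
have nj := bounded_lipschitzZ (c j) (nF j).
split; first exact: bounded_lipschitzD.
by rewrite gavgD// gavgZ// IH2.
Qed.

Definition pairing (D : I -> (I -> R) -> R) x e := \sum_i e i * D i x.

Definition pairing2 (H : I * I -> (I -> R) -> R) x e :=
  \sum_p (e p.1 * e p.2) * H p x.

(* [D] and [H] play the roles of the gradient and the Hessian of [f]. *)
Record smooth C f D H : Prop := Smooth {
  smooth_bl : bounded_lipschitz f;
  smoothD_bl : forall i, bounded_lipschitz (D i);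
  smoothH_bl : forall p, bounded_lipschitz (H p);
  smooth_bound : forall x, `|f x| <= C;
  smoothD_bound : forall i x, `|D i x| <= C;
  smoothH_bound : forall p x, `|H p x| <= C;
  smooth_lip : forall x e, `|f (translate x e) - f x| <= C * norm1 e;
  smoothD_lip : forall i x e, `|D i (translate x e) - D i x| <= C * norm1 e;
  smoothH_lip : forall p x e, `|H p (translate x e) - H p x| <= C * norm1 e;
  smooth_taylor1 : forall x e,
    `|f (translate x e) - f x - pairing D x e| <= C * norm1 e ^+ 2;
  smooth_taylor2 : forall x e,
    `|f (translate x e) - f x - pairing D x e - 2^-1 * pairing2 H x e| <=
    C * norm1 e ^+ 3
}.

Lemma gavg_lip v f (B : R) e : bounded_lipschitz f ->
  (forall x, `|f (translate x e) - f x| <= B) ->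
  forall x, `|gavg v f (translate x e) - gavg v f x| <= B.
Proof.
move=> nf fB x; have nt := bounded_lipschitz_translate e nf.
have nN := bounded_lipschitzZ (-1) nf.
have -> : gavg v f (translate x e) - gavg v f x =
    gavg v (fun x => f (translate x e) + -1 * f x) x.
  by rewrite gavgD// gavg_translate gavgZ// mulN1r.
by apply: gavg_norm_le => [|y]; [exact: bounded_lipschitzD|rewrite mulN1r].
Qed.

(** Each bound in [smooth] is a uniform bound on a linear combination of translates of [f], [D] and
    [H]. Averaging commutes with translations and linear combinations and does not increase the
    supremum, so [C] is kept; hence one constant serves for all iterates. *)
Lemma smooth_gavg C f D H v : smooth C f D H ->
  smooth C (gavg v f) (fun i => gavg v (D i)) (fun p => gavg v (H p)).
Proof.
move=> sf; have [nf nD nH bf bD bH lf lD lH t1 t2] := sf.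
have nt e := bounded_lipschitz_translate e nf.
have nN := bounded_lipschitzZ (-1) nf.
have nDs e := bounded_lipschitz_sum (fun i => - e i) nD.
have nHs e := bounded_lipschitz_sum (fun p => - (2^-1 * (e p.1 * e p.2))) nH.
have ED x e : pairing (fun i => gavg v (D i)) x e =
    - gavg v (fun x => \sum_i - e i * D i x) x.
  by rewrite gavg_sum// -sumrN; apply: eq_bigr => i _; rewrite mulNr opprK.
have EH x e : 2^-1 * pairing2 (fun p => gavg v (H p)) x e =
    - gavg v (fun x => \sum_p - (2^-1 * (e p.1 * e p.2)) * H p x) x.
  rewrite gavg_sum// -sumrN mulr_sumr; apply: eq_bigr => i _.
  by rewrite mulNr opprK mulrA.
split.
- exact: bounded_lipschitz_gavg.
- by move=> i; exact: bounded_lipschitz_gavg.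
- by move=> i; exact: bounded_lipschitz_gavg.
- by move=> x; exact: gavg_norm_le.
- by move=> i x; exact: gavg_norm_le.
- by move=> p x; exact: gavg_norm_le.
- by move=> x e; exact: gavg_lip.
- by move=> i x e; exact: gavg_lip.
- by move=> p x e; exact: gavg_lip.
- move=> x e; have n1 := bounded_lipschitzD (nt e) (bounded_lipschitzD nN (nDs e)).
  have := @gavg_norm_le _ _ _ v x (C * norm1 e ^+ 2) n1.
  rewrite gavgD//; last exact: bounded_lipschitzD.
  rewrite gavgD// gavg_translate gavgZ// mulN1r ED opprK addrA; apply.
  move=> y; have := t1 y e; rewrite mulN1r addrA.
  by rewrite /pairing -sumrN; under eq_bigr do rewrite -mulNr.
- move=> x e.
  have n2 := bounded_lipschitzD (nDs e) (nHs e).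
  have n1 := bounded_lipschitzD (nt e) (bounded_lipschitzD nN n2).
  have := @gavg_norm_le _ _ _ v x (C * norm1 e ^+ 3) n1.
  rewrite gavgD//; last exact: bounded_lipschitzD.
  rewrite gavgD// gavgD// gavg_translate gavgZ// mulN1r ED EH !opprK !addrA; apply.
  move=> y; have := t2 y e; rewrite mulN1r !addrA.
  rewrite /pairing -sumrN; under [X in _ + X - _]eq_bigr do rewrite -mulNr.
  rewrite /pairing2 mulr_sumr -sumrN.
  by under [X in _ + _ + X]eq_bigr do rewrite mulrA -mulNr.
Qed.

Lemma smooth_gavgs C f D H vs : smooth C f D H ->
  smooth C (gavgs vs f) (fun i => gavgs vs (D i)) (fun p => gavgs vs (H p)).
Proof. by move=> sf; elim: vs => //= v vs; exact: smooth_gavg. Qed.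

Lemma gavg_scale_lip f C h v x : 0 < h -> bounded_lipschitz f ->
  (forall x e, `|f (translate x e) - f x| <= C * norm1 e) ->
  `|gavg (scalev h v) f x - f x| <=
  C * h * norm1 v * gauss_mean (fun s => `|s|).
Proof.
move=> h0 nf fC.
have ia : gauss_integrable (fun s : R => `|s|).
  apply: gauss_integrable_poly => [|s]; first exact: normr_measurable.
  rewrite normr_id.
  have -> : s ^+ 4 = `|s| ^+ 4 by rewrite -normrX ger0_norm// exprn_even_ge0.
  by have := sqr_ge0 (`|s| ^+ 2 - 2^-1); have := sqr_ge0 (`|s| - 2^-1); nra.
have -> : gavg (scalev h v) f x - f x =
    gauss_mean (fun s => f (ray x (scalev h v) s) + - f x).
  rewrite gauss_meanD ?gauss_mean_cst//; last exact: gauss_integrable_cst.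
  exact: integrable_ray.
rewrite -gauss_meanZ//; apply: gauss_mean_norm_le.
- apply: gauss_integrableD; [exact: integrable_ray|exact: gauss_integrable_cst].
- exact: gauss_integrableZ.
- move=> s; rewrite rayE (le_trans (fC _ _))// !norm1_scalev (gtr0_norm h0).
  by rewrite le_eqVlt; apply/orP; left; apply/eqP; ring.
Qed.

Lemma gavgs_scale_lip f C h vs x : 0 < h -> bounded_lipschitz f ->
  (forall x e, `|f (translate x e) - f x| <= C * norm1 e) ->
  `|gavgs (map (scalev h) vs) f x - f x| <=
  h * (C * (\sum_(v <- vs) norm1 v) * gauss_mean (fun s => `|s|)).
Proof.
move=> h0 nf fC; elim: vs x => [|v vs IH] x.
  by rewrite subrr normr0 big_nil mulr0 mul0r mulr0.
rewrite /= big_cons; set g := gavgs _ f.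
have -> : gavg (scalev h v) g x - f x = (gavg (scalev h v) g x - g x) + (g x - f x).
  by ring.
have gC y e : `|g (translate y e) - g y| <= C * norm1 e.
  rewrite /g; elim: vs {IH g} y => //= w ws IH y.
  by apply: gavg_lip => //; exact: bounded_lipschitz_gavgs.
have ng : bounded_lipschitz g by exact: bounded_lipschitz_gavgs.
rewrite (le_trans (ler_normD _ _))//.
apply: le_trans (lerD (gavg_scale_lip v x h0 ng gC) (IH x)) _.
by rewrite le_eqVlt; apply/orP; left; apply/eqP; ring.
Qed.

(** Second-order Taylor expansion inside the mean: the linear term vanishes by symmetry, the
    quadratic one keeps the second moment, and the remainder is controlled by the third absolute
    moment. *)
Lemma gavg_step C f D H h v x : smooth C f D H -> 0 < h ->
  `|gavg (scalev h v) f x - f x -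
    h ^+ 2 * 2^-1 * gauss_mean (fun s => s ^+ 2) * pairing2 H x v| <=
  h ^+ 3 * (C * norm1 v ^+ 3 * gauss_mean (fun s => `|s| ^+ 3)).
Proof.
move=> sf h0; have nf := smooth_bl sf.
set m2 := gauss_mean (fun s => s ^+ 2).
have i1 := @gauss_integrable_id R; have i2 := @gauss_integrable_sqr R.
have ir := integrable_ray x (scalev h v) nf.
have ic := gauss_integrable_cst (- f x).
have id1 := gauss_integrableZ (- (h * pairing D x v)) i1.
have id2 := gauss_integrableZ (- (h ^+ 2 * 2^-1 * pairing2 H x v)) i2.
have i12 := gauss_integrableD id1 id2.
have -> : gavg (scalev h v) f x - f x - h ^+ 2 * 2^-1 * m2 * pairing2 H x v =
    gauss_mean (fun s => f (ray x (scalev h v) s) + (- f x +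
      (- (h * pairing D x v) * s + - (h ^+ 2 * 2^-1 * pairing2 H x v) * s ^+ 2))).
  rewrite gauss_meanD//; last exact: gauss_integrableD.
  rewrite gauss_meanD// gauss_meanD// !gauss_meanZ// gauss_mean_cst gauss_mean_id.
  by rewrite mulr0 add0r -/m2 /gavg; ring.
rewrite mulrA -gauss_meanZ; last exact: gauss_integrable_cube.
apply: gauss_mean_norm_le.
- by do 2 apply: gauss_integrableD => //.
- by apply: gauss_integrableZ; exact: gauss_integrable_cube.
- move=> s; have := smooth_taylor2 sf x (scalev s (scalev h v)).
  have -> : pairing D x (scalev s (scalev h v)) = h * pairing D x v * s.
    by rewrite /pairing /scalev !mulr_sumr !mulr_suml; apply: eq_bigr => i _; ring.
  have -> : pairing2 H x (scalev s (scalev h v)) = h ^+ 2 * pairing2 H x v * s ^+ 2.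
    rewrite /pairing2 /scalev !mulr_sumr !mulr_suml; apply: eq_bigr => i _.
    by rewrite /=; ring.
  rewrite !norm1_scalev (gtr0_norm h0) -rayE => t2.
  have -> : h ^+ 3 * (C * norm1 v ^+ 3) * `|s| ^+ 3 =
     C * (`|s| * (h * norm1 v)) ^+ 3 by ring.
  apply: le_trans t2; rewrite le_eqVlt; apply/orP; left; apply/eqP.
  by congr `|_|; ring.
Qed.

(** The covariance matrix of the Gaussian vector behind [gavgs vs]. *)
Definition covariance_form (vs : seq (I -> R)) (p : I * I) : R :=
  \sum_(v <- vs) v p.1 * v p.2.

Lemma pairing2_norm_le C H x v : (forall p, `|H p x| <= C) ->
  `|pairing2 H x v| <= norm1 v ^+ 2 * C.
Proof.
move=> HC; rewrite (le_trans (ler_norm_sum _ _ _))//.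
have -> : norm1 v ^+ 2 = \sum_(p : I * I) `|v p.1 * v p.2|.
  rewrite expr2 /norm1 big_distrlr /= pair_bigA /=.
  by apply: eq_bigr => p _; rewrite normrM.
by rewrite mulr_suml; apply: ler_sum => p _; rewrite normrM ler_wpM2l.
Qed.

(** The order of quantifiers matters: [C'] depends on [C] and [vs] only, so the estimate holds
    uniformly over the functions met during the iteration and over the step size. *)
Lemma gavgs_step C vs : exists C', forall f D H h x, smooth C f D H -> 0 < h ->
  `|gavgs (map (scalev h) vs) f x - f x -
    h ^+ 2 * 2^-1 * gauss_mean (fun s => s ^+ 2) *
      \sum_p covariance_form vs p * H p x| <= h ^+ 3 * C'.
Proof.
elim: vs => [|v vs [C' IH]].
  exists 0 => f D H h x _ _ /=; rewrite big1 ?mulr0 ?subrr ?subr0 ?normr0// => p _.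
  by rewrite /covariance_form big_nil mul0r.
set m2 := gauss_mean (fun s : R => s ^+ 2).
have m2_ge0 : 0 <= m2 by rewrite /m2; apply: Rintegral_ge0 => s _; exact: sqr_ge0.
set S := \sum_(v <- vs) norm1 v.
pose m1 : R := gauss_mean (fun s => `|s|); pose m3 : R := gauss_mean (fun s => `|s| ^+ 3).
exists (C * norm1 v ^+ 3 * m3 + 2^-1 * m2 * (norm1 v ^+ 2 * (C * S * m1)) + C').
move=> f D H h x sf h0 /=; set g := gavgs _ f.
have sg := smooth_gavgs (map (scalev h) vs) sf.
have st1 := gavg_step v x sg h0; rewrite -/g -/m2 -/m3 in st1.
have st2 := IH f D H h x sf h0; rewrite -/g -/m2 in st2.
have -> : \sum_p covariance_form (v :: vs) p * H p x =
    pairing2 H x v + \sum_p covariance_form vs p * H p x.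
  rewrite /pairing2 -big_split /=; apply: eq_bigr => p _.
  by rewrite /covariance_form big_cons mulrDl.
set K := \sum_p _ in st2 *.
set gH := pairing2 (fun p => gavgs _ (H p)) x v in st1.
(* The Hessian of the already averaged [g] differs from [H] by [O(h)], which the factor [h ^+ 2] in
   front turns into an admissible third-order error. *)
have dH : `|gH - pairing2 H x v| <= norm1 v ^+ 2 * (h * (C * S * m1)).
  have -> : gH - pairing2 H x v =
     pairing2 (fun p x => gavgs (map (scalev h) vs) (H p) x - H p x) x v.
    by rewrite /gH /pairing2 -sumrB; apply: eq_bigr => p _; rewrite mulrBr.
  apply: pairing2_norm_le => p.
  by apply: gavgs_scale_lip => //; [exact: smoothH_bl sf p|exact: smoothH_lip sf p].
have h2 : 0 <= h ^+ 2 * 2^-1 * m2 by rewrite mulr_ge0// mulr_ge0 ?sqr_ge0.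
have -> : gavg (scalev h v) g x - f x - h ^+ 2 * 2^-1 * m2 * (pairing2 H x v + K) =
  (gavg (scalev h v) g x - g x - h ^+ 2 * 2^-1 * m2 * gH) +
  (h ^+ 2 * 2^-1 * m2 * (gH - pairing2 H x v)) +
  (g x - f x - h ^+ 2 * 2^-1 * m2 * K) by ring.
rewrite (le_trans (ler_normD _ _))// [leRHS]mulrDr; apply: lerD => //.
rewrite (le_trans (ler_normD _ _))// [leRHS]mulrDr; apply: lerD => //.
rewrite normrM (ger0_norm h2).
apply: le_trans (ler_wpM2l h2 dH) _.
by rewrite le_eqVlt; apply/orP; left; apply/eqP; ring.
Qed.

(* Slepian's inequality, by exchanging the two families in infinitesimal steps:
   [gavgs vX] is the [N]-fold iterate of [gavgs (vX / sqrt N)], and one step changes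
   the mean of a smooth function by half the covariance difference paired with
   the Hessian, up to [O(N^(-3/2))]. *)
Lemma slepian C f D H (vX vY : seq (I -> R)) x : smooth C f D H ->
  (forall i j x, i != j -> 0 <= H (i, j) x) ->
  (forall i, covariance_form vX (i, i) = covariance_form vY (i, i)) ->
  (forall i j, i != j -> covariance_form vY (i, j) <= covariance_form vX (i, j)) ->
  gavgs vY f x <= gavgs vX f x.
Proof.
move=> sf H0 Kd Ko; have [CX stX] := gavgs_step C vX; have [CY stY] := gavgs_step C vY.
set m2 := gauss_mean (fun s : R => s ^+ 2) in stX stY.
have m2_ge0 : 0 <= m2 by rewrite /m2; apply: Rintegral_ge0 => s _; exact: sqr_ge0.
have nf := smooth_bl sf.
pose c := CX + CY.
(* One exchange. The diagonal covariances agree and the off-diagonal differences meet nonnegative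
   Hessian entries, so the second-order terms compare and only the two Taylor errors are lost. *)
have step g D' H' h y : smooth C g D' H' -> (forall i j x, i != j -> 0 <= H' (i, j) x) ->
    0 < h -> gavgs (map (scalev h) vY) g y - h ^+ 3 * c <= gavgs (map (scalev h) vX) g y.
  move=> sg H'0 h0; have := stX _ _ _ h y sg h0; have := stY _ _ _ h y sg h0.
  set SX := \sum_p covariance_form vX p * _; set SY := \sum_p covariance_form vY p * _.
  have SXY : SY <= SX.
    apply: ler_sum => -[i j] _; have [<-|ij] := eqVneq i j; first by rewrite Kd.
    by rewrite ler_wpM2r ?H'0// Ko.
  have k0 : 0 <= h ^+ 2 * 2^-1 * m2 by rewrite mulr_ge0// mulr_ge0 ?sqr_ge0.
  have := ler_wpM2l k0 SXY; rewrite /c mulrDr.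
  by move: (h ^+ 2 * 2^-1 * m2) => k; rewrite !ler_norml => ? /andP[? ?] /andP[? ?]; lra.
(* Exchanging all [k] steps: the outermost one is exchanged by [step], applied to the smooth iterate
   of [vY], and the inner ones by monotonicity of averaging over [vX]. *)
have tele h k y : 0 < h ->
    iter k (gavgs (map (scalev h) vY)) f y - k%:R * (h ^+ 3 * c) <=
    iter k (gavgs (map (scalev h) vX)) f y.
  move=> h0; elim: k y => [|k IH] y; first by rewrite mul0r subr0.
  (* The iterates stay smooth with the same [C], and averaging preserves the sign of the
     off-diagonal Hessian. *)
  have [sk Hk] : exists D' H', smooth C (iter k (gavgs (map (scalev h) vY)) f) D' H' /\
      (forall i j x, i != j -> 0 <= H' (i, j) x).
    elim: k {IH} => [|k [D' [H' [sk H'0]]]]; first by exists D, H.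
    exists (fun i => gavgs (map (scalev h) vY) (D' i)).
    exists (fun p => gavgs (map (scalev h) vY) (H' p)).
    split; first by rewrite iterS; exact: smooth_gavgs.
    move=> i j z ij; rewrite -(@gavgs_cst R I (map (scalev h) vY) 0 z).
    apply: gavgs_le; [exact: bounded_lipschitz_cst|exact: smoothH_bl sk _|].
    by move=> u; exact: H'0.
  case: Hk => H' [skY H'0].
  rewrite !iterS; set gY := iter k _ f in IH skY *; set gX := iter k _ f in IH *.
  have nY := smooth_bl skY.
  have nX : bounded_lipschitz gX.
    by rewrite /gX; elim: (k) => //= m; exact: bounded_lipschitz_gavgs.
  have nc := bounded_lipschitz_cst I (- (k%:R * (h ^+ 3 * c))).
  have := gavgs_le (map (scalev h) vX) y (bounded_lipschitzD nY nc) nX IH.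
  rewrite gavgsD// gavgs_cst; apply: le_trans.
  have := step gY sk H' h y skY H'0 h0.
  by rewrite -[k.+1%:R]natr1; lra.
(* For [h = 1 / sqrt N.+1] the total error [N.+1 * h^3 * c] is [c / sqrt N.+1], which tends to 0. *)
have key N : gavgs vY f x - (Num.sqrt N.+1%:R)^-1 * c <= gavgs vX f x.
  set r : R := Num.sqrt N.+1%:R.
  have r0 : 0 < r by rewrite sqrtr_gt0 ltr0Sn.
  have rn : r != 0 by rewrite gt_eqF.
  have r2 : r ^+ 2 = N.+1%:R by rewrite sqr_sqrtr.
  have h0 : 0 < r^-1 by rewrite invr_gt0.
  have := tele r^-1 N.+1 x h0; rewrite !iter_gavgs// -/r divff//.
  have E1 (vs : seq (I -> R)) : map (scalev 1) vs = vs.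
    rewrite -[RHS]map_id; apply: eq_map => v; apply/funext => i.
    by rewrite /scalev mul1r.
  rewrite !E1.
  suff -> : N.+1%:R * (r^-1 ^+ 3 * c) = r^-1 * c by [].
  by rewrite -r2; field.
apply/ler_addgt0Pr => eps eps0.
have [N hN] : exists N : nat, `|c| / eps < Num.sqrt N.+1%:R.
  exists (Num.truncn ((`|c| / eps) ^+ 2)).
  have q0 : 0 <= `|c| / eps by rewrite divr_ge0// ltW.
  rewrite -[ltLHS]ger0_norm// -sqrtr_sqr ltr_sqrt ?ltr0Sn//.
  exact: truncnS_gt.
have := key N; set r := Num.sqrt N.+1%:R in hN *.
have r0 : 0 < r by rewrite sqrtr_gt0 ltr0Sn.
have : r^-1 * c <= eps.
  apply: le_trans (ler_norm _) _; rewrite normrM gtr0_norm ?invr_gt0//.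
  rewrite mulrC ler_pdivrMr// -ler_pdivrMl// mulrC; exact: ltW.
lra.
Qed.

End Slepian.

(** * Smoothness of products of one-variable functions *)

Section SmoothProducts.
Variables (R : realType) (I : finType).
Implicit Types (x y v w e : I -> R) (f g : (I -> R) -> R).
Implicit Types (D : I -> (I -> R) -> R) (H : I * I -> (I -> R) -> R) (C : R).

Lemma normrM_le (a b A B : R) : `|a| <= A -> `|b| <= B -> `|a * b| <= A * B.
Proof. by move=> aA bB; rewrite normrM; apply: ler_pM. Qed.

Lemma norm_pairing_le C D x e : (forall i x, `|D i x| <= C) ->
  `|pairing D x e| <= C * norm1 e.
Proof.
move=> DC; rewrite (le_trans (ler_norm_sum _ _ _))// mulrC mulr_suml.
by apply: ler_sum => i _; apply: normrM_le.
Qed.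

Lemma dist_prod_le (a a' b b' A B n : R) : `|a'| <= A -> `|b| <= B ->
  `|a' - a| <= A * n -> `|b' - b| <= B * n -> `|a' * b' - a * b| <= 2 * A * B * n.
Proof.
move=> aA bB da db.
have -> : a' * b' - a * b = (a' - a) * b + a' * (b' - b) by ring.
rewrite (le_trans (ler_normD _ _))//.
have := normrM_le da bB; have := normrM_le aA db; lra.
Qed.

(** Leibniz' rules at the level of Taylor remainders. The factor 8 is dictated by the Lipschitz
    bound of the Hessian, a sum of four products each contributing 2. *)
Lemma smoothM C C' f g D D' H H' : smooth C f D H -> smooth C' g D' H' ->
  smooth (8 * C * C') (fun x => f x * g x)
    (fun i x => f x * D' i x + D i x * g x)
    (fun p x => f x * H' p x + D p.1 x * D' p.2 x + (D p.2 x * D' p.1 x + H p x * g x)).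
Proof.
move=> [nf nD nH bf bD bH lf lD lH t1 t2] [nf' nD' nH' bf' bD' bH' lf' lD' lH' t1' t2'].
have C0 : 0 <= C by exact: le_trans (bf (fun=> 0)).
have C0' : 0 <= C' by exact: le_trans (bf' (fun=> 0)).
have CC : 0 <= C * C' by rewrite mulr_ge0.
have EP x e : pairing (fun i x => f x * D' i x + D i x * g x) x e =
    f x * pairing D' x e + pairing D x e * g x.
  rewrite /pairing mulr_sumr mulr_suml -big_split /=.
  by apply: eq_bigr => i _; ring.
split.
- exact: bounded_lipschitzM.
- by move=> i; apply: bounded_lipschitzD; exact: bounded_lipschitzM.
- move=> p; apply: bounded_lipschitzD; apply: bounded_lipschitzD;
    exact: bounded_lipschitzM.
- by move=> x; have := normrM_le (bf x) (bf' x); lra.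
- move=> i x; rewrite (le_trans (ler_normD _ _))//.
  by have := normrM_le (bf x) (bD' i x); have := normrM_le (bD i x) (bf' x); lra.
- move=> p x; rewrite (le_trans (ler_normD _ _))//.
  have := ler_normD (f x * H' p x) (D p.1 x * D' p.2 x).
  have := ler_normD (D p.2 x * D' p.1 x) (H p x * g x).
  have := normrM_le (bf x) (bH' p x); have := normrM_le (bH p x) (bf' x).
  have := normrM_le (bD p.1 x) (bD' p.2 x); have := normrM_le (bD p.2 x) (bD' p.1 x).
  lra.
- move=> x e; have n0 := norm1_ge0 e; have CCn := mulr_ge0 CC n0.
  have := dist_prod_le (bf _) (bf' _) (lf x e) (lf' x e); lra.
- move=> i x e; have n0 := norm1_ge0 e; have CCn := mulr_ge0 CC n0.
  rewrite opprD addrACA (le_trans (ler_normD _ _))//.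
  have := dist_prod_le (bf _) (bD' i _) (lf x e) (lD' i x e).
  have := dist_prod_le (bD i _) (bf' _) (lD i x e) (lf' x e); lra.
- move=> p x e; have n0 := norm1_ge0 e; have CCn := mulr_ge0 CC n0.
  have d1 := dist_prod_le (bf _) (bH' p _) (lf x e) (lH' p x e).
  have d2 := dist_prod_le (bD p.1 _) (bD' p.2 _) (lD p.1 x e) (lD' p.2 x e).
  have d3 := dist_prod_le (bD p.2 _) (bD' p.1 _) (lD p.2 x e) (lD' p.1 x e).
  have d4 := dist_prod_le (bH p _) (bf' _) (lH p x e) (lf' x e).
  move: d1 d2 d3 d4 CCn; set y := translate x e; move: (norm1 e) => n.
  move: (f y * _) (D p.1 y * _) (D p.2 y * _) (H p y * _) => z1 z2 z3 z4.
  move: (f x * _) (D p.1 x * _) (D p.2 x * _) (H p x * _) => w1 w2 w3 w4.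
  rewrite !ler_norml => /andP[? ?] /andP[? ?] /andP[? ?] /andP[? ?] ?.
  by apply/andP; split; lra.
- move=> x e; have n0 := norm1_ge0 e; have n2 := sqr_ge0 (norm1 e).
  have CCn := mulr_ge0 CC n2.
  have p1 := norm_pairing_le x e bD.
  rewrite EP; set a := f _; set b := g _.
  have -> : a * b - f x * g x - (f x * pairing D' x e + pairing D x e * g x) =
    (a - f x - pairing D x e) * b + pairing D x e * (b - g x) +
    f x * (b - g x - pairing D' x e) by ring.
  have := normrM_le (t1 x e) (bf' (translate x e)).
  have := normrM_le p1 (lf' x e); have := normrM_le (bf x) (t1' x e).
  rewrite -/a -/b => u1 u2 u3.
  rewrite (le_trans (ler_normD _ _))//.
  have := ler_normD ((a - f x - pairing D x e) * b) (pairing D x e * (b - g x)); lra.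
- move=> x e; have n0 := norm1_ge0 e; have n3 : 0 <= norm1 e ^+ 3 by rewrite exprn_ge0.
  have CCn := mulr_ge0 CC n3.
  have p1 := norm_pairing_le x e bD.
  have p2 := pairing2_norm_le e (bH^~ x).
  have E2 : pairing2 (fun p x => f x * H' p x + D p.1 x * D' p.2 x +
      (D p.2 x * D' p.1 x + H p x * g x)) x e =
      f x * pairing2 H' x e + 2 * (pairing D x e * pairing D' x e) +
      pairing2 H x e * g x.
    have q1 : pairing D x e * pairing D' x e =
        \sum_(p : I * I) (e p.1 * e p.2) * (D p.1 x * D' p.2 x).
      rewrite /pairing big_distrlr /= pair_bigA /=.
      by apply: eq_bigr => p _; ring.
    have q2 : pairing D x e * pairing D' x e =
        \sum_(p : I * I) (e p.1 * e p.2) * (D p.2 x * D' p.1 x).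
      rewrite mulrC /pairing big_distrlr /= pair_bigA /=.
      by apply: eq_bigr => p _; ring.
    rewrite [2 * _]mulrDl mul1r {1}q1 q2 /pairing2 mulr_sumr mulr_suml -!big_split /=.
    by apply: eq_bigr => p _; ring.
  rewrite EP E2; set a := f _; set b := g _.
  have -> : a * b - f x * g x - (f x * pairing D' x e + pairing D x e * g x) -
    2^-1 * (f x * pairing2 H' x e + 2 * (pairing D x e * pairing D' x e) +
      pairing2 H x e * g x) =
    (a - f x - pairing D x e - 2^-1 * pairing2 H x e) * b +
    f x * (b - g x - pairing D' x e - 2^-1 * pairing2 H' x e) +
    (pairing D x e * (b - g x - pairing D' x e) +
     2^-1 * (pairing2 H x e * (b - g x))) by field.
  have := normrM_le (t2 x e) (bf' (translate x e)).
  have := normrM_le (bf x) (t2' x e).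
  have := normrM_le p1 (t1' x e).
  have := normrM_le p2 (lf' x e).
  rewrite -/a -/b; set u1 := _ * (b - g x); set u2 := pairing D x e * _.
  set u3 := f x * _; set u4 := _ * b => h1 h2 h3 h4.
  have h5 : `|2^-1 * u1| = 2^-1 * `|u1| by rewrite normrM ger0_norm.
  rewrite (le_trans (ler_normD _ _))//.
  have := ler_normD u4 u3; have := ler_normD u2 (2^-1 * u1); rewrite h5; lra.
Qed.

Record smooth1 C (phi phi' phi'' : R -> R) : Prop := Smooth1 {
  smooth1_bounds : forall u : R, [/\ `|phi u| <= C, `|phi' u| <= C & `|phi'' u| <= C];
  smooth1_lips : forall u t : R, [/\ `|phi (u + t) - phi u| <= C * `|t|,
    `|phi' (u + t) - phi' u| <= C * `|t| & `|phi'' (u + t) - phi'' u| <= C * `|t|];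
  smooth1_taylor1 : forall u t : R, `|phi (u + t) - phi u - t * phi' u| <= C * `|t| ^+ 2;
  smooth1_taylor2 : forall u t : R,
    `|phi (u + t) - phi u - t * phi' u - 2^-1 * (t ^+ 2 * phi'' u)| <= C * `|t| ^+ 3 }.

Lemma norm1_coord e i : `|e i| <= norm1 e.
Proof. by rewrite /norm1 (bigD1 i)//= lerDl sumr_ge0. Qed.

Lemma bounded_lipschitz_coord C (phi : R -> R) i :
  (forall u, `|phi u| <= C) -> (forall u t, `|phi (u + t) - phi u| <= C * `|t|) ->
  bounded_lipschitz (fun x : I -> R => phi (x i)).
Proof.
move=> bp lp; have C0 : 0 <= C by exact: le_trans (bp 0).
split; first by exists C.
  exists C => // x y; have := lp (y i) (x i - y i); rewrite subrKC => /le_trans; apply.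
  by rewrite ler_wpM2l//; exact: (norm1_coord (fun i => x i - y i)).
move=> d T F mF; apply: (@measurableT_comp _ _ _ _ _ _ phi _ (fun o => F o i)) => //.
apply: continuous_measurable_fun; apply: (@lipschitz_continuous _ _ C) => s t.
by have := lp t (s - t); rewrite subrKC.
Qed.

Lemma smooth_coord C phi phi' phi'' i : smooth1 C phi phi' phi'' ->
  smooth C (fun x => phi (x i)) (fun j x => (j == i)%:R * phi' (x i))
    (fun p x => (p == (i, i))%:R * phi'' (x i)).
Proof.
move=> [bp lp t1 t2].
have C0 : 0 <= C by have [b _ _] := bp 0; exact: le_trans b.
have b0 u : `|phi u| <= C by have [] := bp u.
have b1 u : `|phi' u| <= C by have [] := bp u.
have b2 u : `|phi'' u| <= C by have [] := bp u.
have l0 u t : `|phi (u + t) - phi u| <= C * `|t| by have [] := lp u t.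
have l1 u t : `|phi' (u + t) - phi' u| <= C * `|t| by have [] := lp u t.
have l2 u t : `|phi'' (u + t) - phi'' u| <= C * `|t| by have [] := lp u t.
have ind (b : bool) (u B : R) : `|u| <= B -> `|b%:R * u| <= B.
  by case: b => uB; rewrite ?mul1r// mul0r normr0 (le_trans _ uB).
have pD x e : pairing (fun j x => (j == i)%:R * phi' (x i)) x e = e i * phi' (x i).
  rewrite /pairing (bigD1 i)//= eqxx mul1r big1 ?addr0// => j /negbTE ->.
  by rewrite mul0r mulr0.
have pH x e : pairing2 (fun p x => (p == (i, i))%:R * phi'' (x i)) x e =
    e i ^+ 2 * phi'' (x i).
  rewrite /pairing2 (bigD1 (i, i))//= eqxx mul1r big1 ?addr0// => j /negbTE ->.
  by rewrite mul0r mulr0.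
split.
- exact: (bounded_lipschitz_coord i b0 l0).
- by move=> j; apply: bounded_lipschitzZ; exact: (bounded_lipschitz_coord i b1 l1).
- by move=> j; apply: bounded_lipschitzZ; exact: (bounded_lipschitz_coord i b2 l2).
- by move=> x.
- by move=> j x; exact: ind.
- by move=> j x; exact: ind.
- by move=> x e; rewrite (le_trans (l0 _ _))// ler_wpM2l// norm1_coord.
- move=> j x e; rewrite -mulrBr; apply: ind.
  by rewrite (le_trans (l1 _ _))// ler_wpM2l// norm1_coord.
- move=> p x e; rewrite -mulrBr; apply: ind.
  by rewrite (le_trans (l2 _ _))// ler_wpM2l// norm1_coord.
- move=> x e; rewrite pD (le_trans (t1 _ _))// ler_wpM2l// lerXn2r ?nnegrE//.
    exact: norm1_ge0.
  exact: norm1_coord.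
- move=> x e; rewrite pD pH (le_trans (t2 _ _))// ler_wpM2l// lerXn2r ?nnegrE//.
    exact: norm1_ge0.
  exact: norm1_coord.
Qed.

Lemma smooth_cst1 : smooth 1 (fun _ : I -> R => 1) (fun _ _ => 0) (fun _ _ => 0).
Proof.
have n := bounded_lipschitz_cst I (0 : R).
have pD x e : pairing (fun _ _ => 0) x e = 0 by rewrite /pairing big1// => i; rewrite mulr0.
have pH x e : pairing2 (fun _ _ => 0) x e = 0.
  by rewrite /pairing2 big1// => i; rewrite mulr0.
split=> //.
- exact: bounded_lipschitz_cst.
- by move=> x; rewrite normr1.
- by move=> i x; rewrite normr0.
- by move=> i x; rewrite normr0.
- by move=> x e; rewrite subrr normr0 mul1r norm1_ge0.
- by move=> i x e; rewrite subrr normr0 mul1r norm1_ge0.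
- by move=> i x e; rewrite subrr normr0 mul1r norm1_ge0.
- by move=> x e; rewrite pD !subr0 subrr normr0 mul1r sqr_ge0.
- by move=> x e; rewrite pD pH mulr0 !subr0 subrr normr0 mul1r exprn_ge0// norm1_ge0.
Qed.

(** This produces the sign condition of Slepian's inequality: for [i != j] the mixed derivative is
    [phi' (x i) phi' (x j)] times nonnegative factors, and two nonpositive numbers have a
    nonnegative product. The induction also carries the signs of the product and of its gradient. *)
Lemma smooth_prod C phi phi' phi'' : smooth1 C phi phi' phi'' ->
  (forall u, 0 <= phi u) -> (forall u, phi' u <= 0) ->
  exists C' D H, smooth C' (fun x => \prod_i phi (x i)) D H /\
    (forall i j x, i != j -> 0 <= H (i, j) x).
Proof.
move=> sp p0 p'0.
suff [C' [D [H [sf _ _ H0]]]] : exists C' D H,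
    [/\ smooth C' (fun x => \prod_i phi (x i)) D H,
        forall x, 0 <= \prod_i phi (x i), forall i x, D i x <= 0 &
        forall i j x, i != j -> 0 <= H (i, j) x] by exists C', D, H.
elim: (index_enum I) => [|k r [C' [D [H [sf f0 D0 H0]]]]].
  exists 1, (fun _ _ => 0), (fun _ _ => 0); split => //.
  - by under eq_fun do rewrite big_nil; exact: smooth_cst1.
  - by move=> x; rewrite big_nil.
exists (8 * C * C'), (fun i x => phi (x k) * D i x +
  (i == k)%:R * phi' (x k) * \prod_(j <- r) phi (x j)).
exists (fun p x => phi (x k) * H p x + (p.1 == k)%:R * phi' (x k) * D p.2 x +
  ((p.2 == k)%:R * phi' (x k) * D p.1 x +
   (p == (k, k))%:R * phi'' (x k) * \prod_(j <- r) phi (x j))).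
split.
- under eq_fun do rewrite big_cons.
  exact: (smoothM (smooth_coord k sp) sf).
- by move=> x; rewrite big_cons mulr_ge0.
- move=> i x; have := mulr_ge0_le0 (p0 (x k)) (D0 i x).
  have := mulr_le0_ge0 (p'0 (x k)) (f0 x).
  by case: (i == k); rewrite ?mul1r ?mul0r ?addr0//; lra.
- move=> i j x ij /=.
  have -> : ((i, j) == (k, k)) = false.
    by apply/negP => /eqP[ik jk]; rewrite ik jk eqxx in ij.
  rewrite !mul0r addr0 addr_ge0//.
    rewrite addr_ge0//; first by rewrite mulr_ge0// H0.
    by apply: mulr_le0 => //; exact: mulr_ge0_le0.
  by apply: mulr_le0 => //; exact: mulr_ge0_le0.
Qed.

End SmoothProducts.

(** * A cubic spline cut-off *)

Section CubicSpline.
Variable R : realType.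
Implicit Types u e : R.

Definition negpart u : R := Num.max 0 (- u).

(* The integral of the quadratic B-spline: it decreases from [1] on [u <= 0] to
   [0] on [u >= 3]. *)
Definition spline u : R := 6^-1 * (negpart (u - 3) ^+ 3 - 3 * negpart (u - 2) ^+ 3 +
  3 * negpart (u - 1) ^+ 3 - negpart u ^+ 3).

Definition spline' u : R := - 2^-1 * (negpart (u - 3) ^+ 2 - 3 * negpart (u - 2) ^+ 2 +
  3 * negpart (u - 1) ^+ 2 - negpart u ^+ 2).

Definition spline'' u : R := negpart (u - 3) - 3 * negpart (u - 2) +
  3 * negpart (u - 1) - negpart u.

Lemma negpartP u : u <= 0 /\ negpart u = - u \/ 0 <= u /\ negpart u = 0.
Proof.
rewrite /negpart; have [u0|u0] := leP u 0; [left|right]; split => //.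
- by rewrite max_r// oppr_ge0.
- exact: ltW.
- by rewrite max_l// oppr_le0 ltW.
Qed.

(** The cube of the negative part is twice differentiable with Lipschitz second derivative; the four
    cases are the signs of [u] and [u + e]. *)
Lemma negpart_taylor u e :
  [/\ `|negpart (u + e) - negpart u| <= `|e|,
      `|negpart (u + e) ^+ 2 - negpart u ^+ 2 + 2 * e * negpart u| <= `|e| ^+ 2 &
      `|negpart (u + e) ^+ 3 - negpart u ^+ 3 + 3 * e * negpart u ^+ 2 -
        3 * e ^+ 2 * negpart u| <= `|e| ^+ 3].
Proof.
have [[u0 ->]|[u0 ->]] := negpartP u; have [[v0 ->]|[v0 ->]] := negpartP (u + e).
- split.
  + by rewrite (_ : _ - _ = - e) ?normrN//; ring.
  + by rewrite (_ : _ + _ = e ^+ 2) ?normrX//; ring.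
  + by rewrite (_ : _ - _ = - e ^+ 3) ?normrN ?normrX//; ring.
- have e0 : 0 <= e by lra.
  rewrite (ger0_norm e0); split.
  + by rewrite ler_norml; apply/andP; split; lra.
  + rewrite (_ : _ + _ = e ^+ 2 - (u + e) ^+ 2); last by ring.
    by rewrite ler_norml; apply/andP; split; nra.
  + rewrite (_ : _ - _ = (u + e) ^+ 3 - e ^+ 3); last by ring.
    have h : (u + e) ^+ 3 <= e ^+ 3 by rewrite lerXn2r// ?nnegrE//; lra.
    have h' : 0 <= (u + e) ^+ 3 by rewrite exprn_ge0.
    by rewrite ler_norml; apply/andP; split; lra.
- have e0 : e <= 0 by lra.
  rewrite (ler0_norm e0); split.
  + by rewrite ler_norml; apply/andP; split; lra.
  + by rewrite ler_norml; apply/andP; split; nra.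
  + have h : (- (u + e)) ^+ 3 <= (- e) ^+ 3 by rewrite lerXn2r// ?nnegrE; lra.
    have h' : 0 <= (- (u + e)) ^+ 3 by rewrite exprn_ge0//; lra.
    rewrite (_ : _ - _ = (- (u + e)) ^+ 3); last by ring.
    by rewrite ler_norml; apply/andP; split; lra.
- rewrite !expr0n /= !mulr0 !subr0 !addr0 normr0.
  by split; rewrite ?exprn_ge0.
Qed.

(** Of the sixteen sign patterns at the knots 0, 1, 2, 3 five are consistent, one for each
    polynomial piece. *)
Lemma spline_values u :
  [/\ 0 <= spline u <= 1, -1 <= spline' u <= 0, -1 <= spline'' u <= 1,
      u <= 0 -> spline u = 1 & 3 <= u -> spline u = 0].
Proof.
rewrite /spline /spline' /spline''.
have [[a0 ->]|[a0 ->]] := negpartP u; have [[b0 ->]|[b0 ->]] := negpartP (u - 1);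
 have [[c0 ->]|[c0 ->]] := negpartP (u - 2); have [[d0 ->]|[d0 ->]] := negpartP (u - 3);
 try (exfalso; lra).
- by split; [apply/andP; split; lra..|by move=> _; field|by move=> h; exfalso; lra].
- have -> : 6^-1 * ((- (u - 3)) ^+ 3 - 3 * (- (u - 2)) ^+ 3 + 3 * (- (u - 1)) ^+ 3 -
     0 ^+ 3) = 1 - u ^+ 3 / 6 by field.
  have u3 : 0 <= u ^+ 3 by rewrite exprn_ge0.
  have u31 : u ^+ 3 <= 1 by rewrite exprn_ile1//; lra.
  split; [apply/andP; split; nra..|move=> h; have -> : u = 0 by lra|move=> h; exfalso; lra].
  by field.
(* The middle piece, [1 <= u <= 2], in the coordinate [w = 2 - u] of [[0, 1]]; the bounds follow
   from the nonnegative polynomials listed next. *)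
- have [w [w0 w1 uw]] : exists w, [/\ 0 <= w, w <= 1 & u = 2 - w].
    by exists (2 - u); split; lra.
  have w3 : 0 <= w ^+ 3 by rewrite exprn_ge0.
  have w32 : 0 <= w ^+ 2 * (1 - w) by rewrite mulr_ge0 ?sqr_ge0//; lra.
  have w4 : 0 <= w * (1 - w) by rewrite mulr_ge0//; lra.
  have w5 : 0 <= (1 - w) ^+ 2 * (1 + 2 * w) by rewrite mulr_ge0 ?sqr_ge0//; lra.
  have w6 : 0 <= (2 * w - 1) ^+ 2 by exact: sqr_ge0.
  rewrite uw; split; [apply/andP; split; lra..|move=> h; exfalso; lra|move=> h; exfalso; lra].
- have u3 : 0 <= (- (u - 3)) ^+ 3 by rewrite exprn_ge0//; lra.
  have u31 : (- (u - 3)) ^+ 3 <= 1 by rewrite exprn_ile1//; lra.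
  split; [apply/andP; split; nra..|move=> h; exfalso; lra|move=> h].
  have -> : u = 3 by lra.
  by field.
- split; [apply/andP; split; lra..|move=> h; exfalso; lra|by move=> h; field].
Qed.

(** The absolute coefficients 1, 3, 3, 1 sum to 8, so the top remainders have constants 8/6, 8/2 and
    8 for [spline], [spline'] and [spline'']. The value 100 is a generous common bound. *)
Lemma spline_smooth1 : smooth1 100 spline spline' spline''.
Proof.
have nl (a B : R) : - B <= a <= B -> `|a| <= B by rewrite ler_norml.
have t3 u e : `|spline (u + e) - spline u - e * spline' u -
    2^-1 * (e ^+ 2 * spline'' u)| <= 2 * `|e| ^+ 3.
  have [_ _ d0] := negpart_taylor u e; have [_ _ d1] := negpart_taylor (u - 1) e.
  have [_ _ d2] := negpart_taylor (u - 2) e; have [_ _ d3] := negpart_taylor (u - 3) e.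
  rewrite /spline /spline' /spline'' !(addrAC u e); move: d0 d1 d2 d3.
  have : 0 <= `|e| ^+ 3 by rewrite exprn_ge0.
  move: (`|e| ^+ 3) => E E0; rewrite !ler_norml => /andP[? ?] /andP[? ?] /andP[? ?] /andP[? ?].
  by apply/andP; split; lra.
have t2 u e : `|spline' (u + e) - spline' u - e * spline'' u| <= 4 * `|e| ^+ 2.
  have [_ d0 _] := negpart_taylor u e; have [_ d1 _] := negpart_taylor (u - 1) e.
  have [_ d2 _] := negpart_taylor (u - 2) e; have [_ d3 _] := negpart_taylor (u - 3) e.
  rewrite /spline' /spline'' !(addrAC u e); move: d0 d1 d2 d3.
  move: (`|e| ^+ 2) => E; rewrite !ler_norml => /andP[? ?] /andP[? ?] /andP[? ?] /andP[? ?].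
  by apply/andP; split; lra.
have t1 u e : `|spline'' (u + e) - spline'' u| <= 8 * `|e|.
  have [d0 _ _] := negpart_taylor u e; have [d1 _ _] := negpart_taylor (u - 1) e.
  have [d2 _ _] := negpart_taylor (u - 2) e; have [d3 _ _] := negpart_taylor (u - 3) e.
  rewrite /spline'' !(addrAC u e); move: d0 d1 d2 d3.
  move: (`|e|) => E; rewrite !ler_norml => /andP[? ?] /andP[? ?] /andP[? ?] /andP[? ?].
  by apply/andP; split; lra.
have b0 u : `|spline u| <= 1.
  by have [/andP[? ?] _ _ _ _] := spline_values u; apply: nl; apply/andP; split; lra.
have b1 u : `|spline' u| <= 1.
  by have [_ /andP[? ?] _ _ _] := spline_values u; apply: nl; apply/andP; split; lra.
have b2 u : `|spline'' u| <= 1.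
  by have [_ _ /andP[? ?] _ _] := spline_values u; apply: nl; apply/andP; split; lra.
(* For [|e| <= 1] lower-order remainders follow from the higher-order ones, for
   [|e| >= 1] from the bounds. *)
have T1 u e : `|spline (u + e) - spline u - e * spline' u| <= 4 * `|e| ^+ 2.
  have n0 := normr_ge0 e; have := b0 (u + e); have := b0 u.
  have := normrM_le (lexx `|e|) (b1 u); have := t3 u e.
  have : `|2^-1 * (e ^+ 2 * spline'' u)| <= 2^-1 * `|e| ^+ 2.
    rewrite normrM ger0_norm// ler_wpM2l// -[leRHS]mulr1; apply: normrM_le => //.
    by rewrite normrX.
  have [e1|e1] := leP `|e| 1.
    have : `|e| ^+ 3 <= `|e| ^+ 2 by rewrite exprSr ler_piMr// sqr_ge0.
    move: (e * spline' u) (2^-1 * (e ^+ 2 * _)) => p q.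
    move: (`|e| ^+ 3) (`|e| ^+ 2) => E3 E2.
    rewrite !ler_norml => ? /andP[? ?] /andP[? ?] _ _ _.
    by apply/andP; split; lra.
  have : `|e| <= `|e| ^+ 2 by rewrite expr2 ler_peMl// ltW.
  move=> + _ _; move: (e * spline' u) => p; move: (`|e| ^+ 2) => E2.
  move: `|e| n0 e1 => E n0 e1.
  rewrite !ler_norml => E12 /andP[? ?] /andP[? ?] /andP[? ?].
  by apply/andP; split; lra.
split.
- by move=> u; have := b0 u; have := b1 u; have := b2 u; split; lra.
- move=> u e; have n0 := normr_ge0 e; split.
  + have := normrM_le (lexx `|e|) (b1 u); have := T1 u e.
    have := b0 (u + e); have := b0 u; have [e1|e1] := leP `|e| 1.
      have : `|e| ^+ 2 <= `|e| by rewrite expr2 ler_piMr.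
      move: (e * spline' u) (`|e| ^+ 2) => p E2; move: `|e| n0 e1 => E n0 e1.
      rewrite !ler_norml => ? /andP[? ?] /andP[? ?] /andP[? ?] /andP[? ?].
      by apply/andP; split; lra.
    move: `|e| n0 e1 => E n0 e1; rewrite !ler_norml => /andP[? ?] /andP[? ?] _ _.
    by apply/andP; split; lra.
  + have := normrM_le (lexx `|e|) (b2 u); have := t2 u e.
    have := b1 (u + e); have := b1 u; have [e1|e1] := leP `|e| 1.
      have : `|e| ^+ 2 <= `|e| by rewrite expr2 ler_piMr.
      move: (e * spline'' u) (`|e| ^+ 2) => p E2; move: `|e| n0 e1 => E n0 e1.
      rewrite !ler_norml => ? /andP[? ?] /andP[? ?] /andP[? ?] /andP[? ?].
      by apply/andP; split; lra.
    move: `|e| n0 e1 => E n0 e1; rewrite !ler_norml => /andP[? ?] /andP[? ?] _ _.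
    by apply/andP; split; lra.
  + by have := t1 u e; lra.
- by move=> u e; have := T1 u e; have := sqr_ge0 `|e|; lra.
- move=> u e; have := t3 u e; have : 0 <= `|e| ^+ 3 by rewrite exprn_ge0.
  lra.
Qed.

End CubicSpline.

(** * From independent random variables to iterated Gaussian averages *)

Section LawOfGaussianFamily.
Context (dT : measure_display) (T : measurableType dT) (R : realType).
Variables (P : probability T R) (K : finType) (Z : K -> {RV P >-> R}).
Hypothesis iidZ : iid_std_normal Z.
Local Notation gam := (@normal_prob R 0 1).

(* Events determined by the variables other than [Z k]. *)
Definition rectangles (k : K) : set (set T) :=
  [set A | exists B : K -> set R, [/\ forall j, measurable (B j), B k = setT &
     A = \bigcap_(j in [set: K]) (Z j @^-1` B j)]].

Lemma measurable_rectangles k A : rectangles k A -> measurable A.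
Proof.
move=> [B [mB _ ->]]; apply: fin_bigcap_measurable => // j _.
by rewrite -[_ @^-1` _]setTI; exact: measurable_funP.
Qed.

Lemma rectangles_setI_closed k : setI_closed (rectangles k).
Proof.
move=> _ _ [B [mB Bk ->]] [B' [mB' B'k ->]].
exists (fun j => B j `&` B' j); split.
- by move=> j; exact: measurableI.
- by rewrite Bk B'k setTI.
- by rewrite -bigcapI; apply: eq_bigcapr => j _; rewrite preimage_setI.
Qed.

Lemma rectangles_indep k A B0 : rectangles k A -> measurable B0 ->
  (P (A `&` (Z k @^-1` B0)) = P A * gam B0)%E.
Proof.
move=> [B [mB Bk ->]] mB0; have [ind law] := iidZ.
have -> : \bigcap_(j in [set: K]) (Z j @^-1` B j) `&` (Z k @^-1` B0) =
    \bigcap_(j in [set: K]) (Z j @^-1` (if j == k then B0 else B j)).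
  apply/seteqP; split => w /=.
    by move=> [wB wB0] j _; case: eqP => [->|_] //; exact: wB.
  move=> wB; split; last by have := wB k I; rewrite eqxx.
  by move=> j _; have := wB j I; case: eqP => [->|//]; rewrite Bk.
rewrite ind; last by move=> j; case: ifP.
rewrite ind// (bigD1 k)//= [in RHS](bigD1 k)//= eqxx Bk preimage_setT probability_setT mul1e.
rewrite muleC; congr (_ * _)%E; last exact: law.
by apply: eq_bigr => j /negbTE ->.
Qed.

(** Dynkin's argument: the events independent of [E] form a lambda-system, and it contains the
    intersection-stable family [rectangles k]. *)
Lemma sigma_rectangles_indep k A B0 : <<s rectangles k >> A -> measurable B0 ->
  measurable A /\ (P (A `&` (Z k @^-1` B0)) = P A * gam B0)%E.
Proof.
move=> sA mB0; set E := Z k @^-1` B0.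
have mE : measurable E by rewrite /E -[_ @^-1` _]setTI; exact: measurable_funP.
have [r rE] : exists r, gam B0 = r%:E.
  by exists (fine (gam B0)); rewrite fineK//; exact: fin_num_measure.
have PE : P E = r%:E by rewrite -rE; have [_ law] := iidZ; exact: law.
have aux (a b : \bar R) : a \is a fin_num -> b \is a fin_num ->
    (a * r%:E - b * r%:E = (a - b) * r%:E)%E.
  move=> /fineK <- /fineK <-.
  by rewrite -[LHS]/((fine a * r - fine b * r)%:E) -mulrBl.
pose H := [set A | measurable A /\ (P (A `&` E) = P A * r%:E)%E].
suff /(_ _ sA)[mA HA] : <<s rectangles k >> `<=` H by split => //; rewrite rE.
apply: lambda_system_subset => //; first exact: rectangles_setI_closed.
- split => //.
  + by split => //; rewrite setTI probability_setT mul1e PE.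
  + move=> A1 A2 A21 [m1 e1] [m2 e2]; split; first exact: measurableD.
    have -> : (A1 `\` A2) `&` E = (A1 `&` E) `\` (A2 `&` E).
      by apply/seteqP; split => w /=; tauto.
    rewrite !measureD//; try (by exact: measurableI); try (by rewrite ltey_eq fin_num_measure//; exact: measurableI).
    have A21E : A2 `&` E `<=` A1 `&` E by move=> w [/A21 ? ?].
    rewrite (setIidr A21) (setIidr A21E).
    have f1 : P A1 \is a fin_num by exact: fin_num_measure.
    have f2 : P A2 \is a fin_num by exact: fin_num_measure.
    rewrite [X in (X - _)%E]e1 [X in (_ - X)%E]e2.
    exact: aux.
  + move=> F ndF HF.
    have mF n : measurable (F n) by have [] := HF n.
    have mU : measurable (\bigcup_i F i) by exact: bigcupT_measurable.
    split => //; rewrite setI_bigcupl.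
    have c1 := nondecreasing_cvg_mu (mu := P) mF mU ndF.
    have mFE n : measurable (F n `&` E) by exact: measurableI.
    have ndFE : nondecreasing_seq (fun n => F n `&` E).
      by move=> m n mn; apply/subsetPset; apply: setSI; apply/subsetPset/ndF.
    have c2 := nondecreasing_cvg_mu (mu := P) mFE (bigcupT_measurable _ mFE) ndFE.
    have c3 : (P \o (fun n => F n `&` E)) @ \oo --> (P (\bigcup_i F i) * r%:E)%E.
      rewrite (_ : _ \o _ = (fun n => P (F n) * r%:E)%E).
        by apply: cvgeZr.
      by apply/funext => n /=; have [_ ->] := HF n.
    exact: (cvg_unique _ c2 c3).
- by move=> X rX; split; [exact: measurable_rectangles rX|rewrite -rE; exact: rectangles_indep].
Qed.

(** The sample space with the coarser sigma-algebra generated by the variables other than [Z k];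
    measurability on [R * T' k] then expresses dependence on [w] through those variables only. *)
Let T' k := g_sigma_algebraType (rectangles k).

Lemma measurable_coord_rectangles k j : j != k ->
  measurable_fun [set: T' k] (fun w : T' k => Z j w).
Proof.
move=> jk _ B mB; rewrite setTI; apply: sub_sigma_algebra.
exists (fun i => if i == j then B else setT); split.
- by move=> i; case: ifP.
- by rewrite eq_sym (negbTE jk).
- apply/seteqP; split => w /=; first by move=> wB i _; case: eqP => // ->.
  by move=> /(_ j I); rewrite eqxx.
Qed.

(** By independence the law of [(Z k w, w)] on [R * T' k] is the product of the Gaussian law and the
    law of [w], so Tonelli integrates [Z k] out with the others frozen. *)
Lemma integral_peel k (F : R * T' k -> R) :
  measurable_fun [set: R * T' k] F -> (forall p, 0 <= F p) ->
  (\int[P]_w (F (Z k w, w))%:E = \int[P]_w \int[gam]_s (F (s, w))%:E)%E.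
Proof.
move=> mF F0.
have mid : measurable_fun [set: T] (fun w => w : T' k).
  by move=> _ B mB; rewrite setTI; have [] := @sigma_rectangles_indep k B setT mB measurableT.
pose M := measurableTypeR R; pose phi (w : T) : M * T' k := (Z k w, w).
have mZ : measurable_fun [set: T] (Z k : T -> M) .
  have mZ0 : measurable_fun [set: T] (Z k) by [].
  exact: mZ0.
have mphi : measurable_fun [set: T] phi by exact: measurable_fun_pair.
have mFe : measurable_fun [set: M * T' k] (fun p : M * T' k => (F p)%:E).
  by apply/measurable_EFinP; exact: mF.
have Fe0 p : (0 <= (F p)%:E)%E by rewrite lee_fin.
pose idT : {mfun T >-> T' k} := HB.pack (fun w => w : T' k)
  (isMeasurableFun.Build _ _ _ _ _ mid).
pose phiT : {mfun T >-> (M * T' k)%type} := HB.pack phi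
  (isMeasurableFun.Build _ _ _ _ _ mphi).
pose P' : probability (T' k) R := distribution P idT.
pose Q : probability (M * T' k)%type R := distribution P phiT.
have E1 (X : set (M * T' k)) : measurable X -> (gam \x P')%E X = Q X.
  apply: product_measure_unique => A B mA mB.
  have [mB' ind] := @sigma_rectangles_indep k B A mB mA.
  transitivity (P (B `&` Z k @^-1` A)); first by rewrite setIC.
  by rewrite muleC; exact: ind.
transitivity (\int[Q]_p (F p)%:E)%E.
  by rewrite (@ge0_integral_distribution _ _ _ _ _ _ phiT (fun p => (F p)%:E)).
transitivity (\int[(gam \x P')%E]_p (F p)%:E)%E.
  by apply: eq_measure_integral => A mA _; first [exact: E1|exact/esym/E1].
rewrite (fubini_tonelli2 (fun p : M * T' k => (F p)%:E))//.
rewrite (@ge0_integral_distribution _ _ _ _ _ _ idT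
  (fun w => \int[gam]_s (F (s, w))%:E)%E)//.
- exact: (measurable_fun_fubini_tonelli_G (fun p : M * T' k => (F p)%:E)).
- by move=> w; apply: integral_ge0 => s _; rewrite lee_fin.
Qed.

(** The bridge from probability to averaging operators. Variables are peeled off one at a time;
    [uniq ks] ensures that the peeled variable is not among the remaining ones. *)
Lemma ge0_integral_gaussian_family (I : finType) (v : K -> I -> R) (ks : seq K)
    (f : (I -> R) -> R) (x : I -> R) : uniq ks -> bounded_lipschitz f ->
  (forall y, 0 <= f y) ->
  (\int[P]_w (f (fun i => x i + \sum_(k <- ks) Z k w * v k i)%R)%:E =
   (gavgs (map v ks) f x)%:E)%E.
Proof.
elim: ks f => [|k ks IH] f /= uks nf f0.
  under eq_integral => w _.
    rewrite (_ : (fun i => _) = x); last first.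
      by apply/funext => i; rewrite big_nil addr0.
    over.
  by rewrite integral_cst//= probability_setT mule1.
have /andP[kks uks'] := uks; have [[B fB] _ mf] := nf.
pose F (p : R * T' k) := f (fun i => x i + \sum_(j <- ks) Z j p.2 * v j i + p.1 * v k i).
have mF : measurable_fun [set: R * T' k] F.
  apply: (mf _ (R * T' k)%type (fun p i => x i + \sum_(j <- ks) Z j p.2 * v j i + p.1 * v k i)).
  move=> i; apply: measurable_funD; last exact: measurable_funM.
  apply: measurable_funD => //.
  elim: ks {IH uks uks' F} kks => [_|j ks IH].
    rewrite (_ : (fun p : R * T' k => _) = (fun=> 0))//.
    by apply/funext => p; rewrite big_nil.
  rewrite inE negb_or eq_sym => /andP[jk kks].
  rewrite (_ : (fun p : R * T' k => _) =
      (fun p => Z j p.2 * v j i + \sum_(l <- ks) Z l p.2 * v l i)); last first.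
    by apply/funext => p; rewrite big_cons.
  apply: measurable_funD; last exact: IH.
  apply: measurable_funM => //.
  exact: (measurableT_comp (measurable_coord_rectangles jk) measurable_snd).
have := integral_peel mF (fun p => f0 _); rewrite /F /=.
have -> : (\int[P]_w (f (fun i => x i + \sum_(j <- ks) Z j w * v j i + Z k w * v k i)%R)%:E =
   \int[P]_w (f (fun i => x i + \sum_(j <- k :: ks) Z j w * v j i)%R)%:E)%E.
  apply: eq_integral => w _; congr (f _)%:E; apply/funext => i.
  by rewrite big_cons [in RHS]addrCA addrC.
move=> ->; rewrite gavg_gavgsC// -IH//.
- by apply: eq_integral => w _; rewrite -EFin_gauss_mean//; exact: (integrable_ray _ _ nf).
- exact: bounded_lipschitz_gavg.
- by move=> y; apply: Rintegral_ge0 => s _.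
Qed.

End LawOfGaussianFamily.

(** * Tail of the maximum of a Gaussian family *)

Section SlepianTail.
Variable R : realType.

(** A deterministic lower bound in the Gaussian coordinates [ss] is integrated one coordinate at a
    time; [C] absorbs the exponential weights of the coordinates already fixed. *)
Lemma gavgs_chernoff (I : finType) (l C : R) (vs : seq (I -> R)) (f : (I -> R) -> R)
    (x : I -> R) : l < 2^-1 -> bounded_lipschitz f ->
  (forall ss : seq R, size ss = size vs ->
     1 - C * \prod_(s <- ss) expR (l * s ^+ 2) <=
     f (fun i => x i + \sum_(p <- zip ss vs) p.1 * p.2 i)) ->
  1 - C * (Num.sqrt (1 - 2 * l))^-1 ^+ size vs <= gavgs vs f x.
Proof.
move=> l2 nf; have [ie me] := gauss_mean_expR_sqr l2.
elim: vs C x => [|v vs IH] C x H /=.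
  have := H [::] erefl; rewrite big_nil.
  by rewrite (_ : (fun i => _) = x)//; apply/funext => i; rewrite big_nil addr0.
set M := (Num.sqrt _)^-1 in me IH *.
have i1 := gauss_integrable_cst (1 : R).
have i2 := gauss_integrableZ (- (C * M ^+ size vs)) ie.
have -> : 1 - C * M ^+ (size vs).+1 = gauss_mean (fun s : R =>
    1 + - (C * M ^+ size vs) * expR (l * s ^+ 2)).
  by rewrite gauss_meanD// gauss_mean_cst gauss_meanZ// me exprS; ring.
apply: gauss_mean_le.
- exact: gauss_integrableD.
- by apply: integrable_ray; exact: bounded_lipschitz_gavgs.
- move=> s; have := IH (C * expR (l * s ^+ 2)) (ray x v s).
  rewrite mulNr mulrAC; apply => ss sss.
  have := H (s :: ss); rewrite /= sss => /(_ erefl); rewrite big_cons mulrA.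
  rewrite (_ : (fun i => _) = (fun i => ray x v s i + \sum_(p <- zip ss vs) p.1 * p.2 i))//.
  by apply/funext => i; rewrite big_cons addrA.
Qed.

(** Young's inequality in place of Cauchy-Schwarz: when the [v i] have square sum 2 and the [ss]
    have square sum at most [t^2 / 2], the right-hand side is at most [t]. *)
Lemma sum_zip_le (I : finType) (t : R) (ss : seq R) (vs : seq (I -> R)) (i : I) :
  0 < t -> size ss = size vs ->
  \sum_(p <- zip ss vs) p.1 * p.2 i <=
  (\sum_(s <- ss) s ^+ 2) / t + t / 4 * \sum_(v <- vs) v i ^+ 2.
Proof.
move=> t0; have tn : t != 0 by rewrite gt_eqF.
elim: ss vs => [|s ss IH] [|v vs]//=.
  by rewrite !big_nil mul0r mulr0 addr0.
move=> [sv]; rewrite !big_cons /=; have := IH _ sv.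
suff : s * v i <= s ^+ 2 / t + t / 4 * v i ^+ 2 by rewrite mulrDr mulrDl; lra.
rewrite -subr_ge0.
have -> : s ^+ 2 / t + t / 4 * v i ^+ 2 - s * v i = (s - t / 2 * v i) ^+ 2 / t by field.
by rewrite divr_ge0 ?sqr_ge0// ltW.
Qed.

Lemma prod_expR_sqr (l : R) (ss : seq R) :
  \prod_(s <- ss) expR (l * s ^+ 2) = expR (l * \sum_(s <- ss) s ^+ 2).
Proof.
elim: ss => [|s ss IH]; first by rewrite !big_nil mulr0 expR0.
by rewrite !big_cons IH -expRD mulrDr.
Qed.

Lemma prod_spline (I : finType) (y : I -> R) :
  [/\ 0 <= \prod_i spline (y i) <= 1,
     (forall i, y i <= 0) -> \prod_i spline (y i) = 1 &
     forall i, 3 <= y i -> \prod_i spline (y i) = 0].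
Proof.
have S01 (u : R) : 0 <= spline u <= 1 by have [] := spline_values u.
split.
- apply/andP; split; first by apply: prodr_ge0 => i _; have /andP[] := S01 (y i).
  rewrite -[leRHS](@big1_eq _ 1 *%R I (index_enum I) xpredT).
  by apply: ler_prod => i _; exact: S01.
- by move=> y0; rewrite big1// => i _; have [_ _ _ ->] := spline_values (y i).
- by move=> i yi; rewrite (bigD1 i)//=; have [_ _ _ _ ->] := spline_values (y i); rewrite ?mul0r.
Qed.

Lemma covariance_form_scalev (I : finType) (b : R) (vs : seq (I -> R)) p :
  covariance_form (map (scalev b) vs) p = b ^+ 2 * covariance_form vs p.
Proof.
rewrite /covariance_form big_map mulr_sumr; apply: eq_bigr => v _.
by rewrite /scalev; ring.
Qed.

Lemma covariance_form_enum (I K : finType) (v : K -> I -> R) i j :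
  covariance_form (map v (enum K)) (i, j) = \sum_k v k i * v k j.
Proof. by rewrite /covariance_form big_map big_enum. Qed.

(* Symmetrising the common Gaussian shift: it is of the helpful sign half of the
   time. *)
Lemma gavg_common_shift_le (I : finType) (c : R) (y : I -> R) :
  bounded_lipschitz (fun x : I -> R => \prod_i spline (x i)) ->
  gavg (fun=> c) (fun x : I -> R => \prod_i spline (x i)) y <=
  1 - 2^-1 * [exists i, 3 <= y i]%:R.
Proof.
set f := fun x : I -> R => _; move=> nf.
have f01 x : 0 <= f x <= 1 by have [] := prod_spline x.
have ir := integrable_ray y (fun=> c) nf.
have mr := gauss_integrable_measurable ir.
have irN : gauss_integrable (fun s => f (ray y (fun=> c) (- s))).
  apply: (gauss_integrable_bounded (B := 1)).
    by apply: (measurableT_comp mr).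
  by move=> s; have /andP[? ?] := f01 (ray y (fun=> c) (- s)); rewrite ger0_norm.
have -> : gavg (fun=> c) f y = gauss_mean (fun s =>
    2^-1 * (f (ray y (fun=> c) s) + f (ray y (fun=> c) (- s)))).
  rewrite gauss_meanZ; last exact: gauss_integrableD.
  rewrite gauss_meanD// (gauss_meanN mr) -/(gavg _ _ _).
  by field.
rewrite -[leRHS]gauss_mean_cst; apply: gauss_mean_le.
- by apply: gauss_integrableZ; exact: gauss_integrableD.
- exact: gauss_integrable_cst.
move=> s; have /andP[p0 p1] := f01 (ray y (fun=> c) s).
have /andP[q0 q1] := f01 (ray y (fun=> c) (- s)).
case: existsP => [[i yi]|_] /=; last by lra.
have [sc|sc] := leP 0 (s * c).
  have : f (ray y (fun=> c) s) = 0.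
    by have [_ _ /(_ i)] := prod_spline (ray y (fun=> c) s); apply; rewrite /ray; lra.
  lra.
have : f (ray y (fun=> c) (- s)) = 0.
  by have [_ _ /(_ i)] := prod_spline (ray y (fun=> c) (- s)); apply; rewrite /ray; lra.
lra.
Qed.

(** The mean of the cut-off is squeezed: for the comparison family [vY] it is at least 1 minus a
    chi-square tail, for [vX] plus the common Gaussian of standard deviation [a] it is at most 1
    minus half the probability sought. This half is the origin of the factor 2. *)
Lemma slepian_tail (dT : measure_display) (T : measurableType dT)
    (P : probability T R) (I J K : finType) (Z : K -> {RV P >-> R})
    (vX : K -> I -> R) (vY : J -> I -> R) (a l t t' : R) :
  iid_std_normal Z -> 0 <= l -> l < 2^-1 -> 0 < t -> t < t' ->
  (forall i, \sum_j vY j i ^+ 2 = 2) ->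
  (forall i, \sum_k vX k i ^+ 2 + a ^+ 2 = 2) ->
  (forall i j, i != j -> \sum_m vY m i * vY m j <= \sum_k vX k i * vX k j + a ^+ 2) ->
  (P [set w | exists i, (t' <= \sum_k Z k w * vX k i)%R] <=
   (2 * (expR (- (l * (t ^+ 2 / 2))) * (Num.sqrt (1 - 2 * l))^-1 ^+ #|J|))%:E)%E.
Proof.
move=> iidZ l0 l2 t0 tt' dY dX cXY.
(* The scale [b] and the base point [x0] below map [[t, t']] onto [[0, 3]], where the spline falls
   from 1 to 0. *)
pose b := 3 / (t' - t); have d0 : 0 < t' - t by lra.
have dn : t' - t != 0 by rewrite gt_eqF.
have b0 : 0 < b by rewrite divr_gt0.
have bE : b * (t' - t) = 3 by rewrite /b divfK.
pose f := fun x : I -> R => \prod_i spline (x i).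
have spl0 (u : R) : 0 <= spline u by have [/andP[]] := spline_values u.
have spl'0 (u : R) : spline' u <= 0 by have [_ /andP[]] := spline_values u.
have [C [D [H [sf H0]]]] := @smooth_prod R I _ _ _ _ (@spline_smooth1 R) spl0 spl'0.
have nf : bounded_lipschitz f := smooth_bl sf.
have f01 x : 0 <= f x <= 1 by have [] := prod_spline x.
pose x0 : I -> R := fun=> - (b * t).
(* The constant direction is the common Gaussian: it adds [a ^+ 2] to every covariance. *)
pose lX := (fun=> a) :: map vX (enum K); pose lY := map vY (enum J).
have lowY : 1 - expR (- (l * (t ^+ 2 / 2))) * (Num.sqrt (1 - 2 * l))^-1 ^+ #|J| <=
    gavgs (map (scalev b) lY) f x0.
  have szY : size (map (scalev b) lY) = #|J| by rewrite /lY 2!size_map [RHS]cardT.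
  rewrite -szY; apply: gavgs_chernoff => // ss sss.
  rewrite prod_expR_sqr -expRD; set S := \sum_(s <- ss) s ^+ 2.
  set y := fun i => _.
  have /andP[fy0 fy1] := f01 y.
  (* Where the Gaussian vector is long the lower bound is nonpositive; where it is short all
     coordinates stay below [t] and the cut-off equals 1. *)
  have [S0|S0] := leP (t ^+ 2 / 2) S.
    apply: le_trans fy0; rewrite subr_le0 -[leLHS]expR0 ler_expR.
    have := ler_wpM2l l0 S0; lra.
  have -> : f y = 1.
    have [_ f1 _] := prod_spline y; apply: f1 => i; rewrite /y /x0.
    have -> : \sum_(p <- zip ss (map (scalev b) lY)) p.1 * p.2 i =
        b * \sum_(p <- zip ss lY) p.1 * p.2 i.
      elim: (lY) (ss) => [|v vs IH] [|s s']; rewrite ?big_nil ?mulr0//.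
      by rewrite /= !big_cons IH /scalev /=; ring.
    have szs : size ss = size lY by rewrite sss size_map.
    have := sum_zip_le i t0 szs.
    have -> : \sum_(v <- lY) v i ^+ 2 = 2 by rewrite -(dY i) big_map big_enum.
    have : S / t <= t / 2.
      by rewrite ler_pdivrMr// (le_trans (ltW S0))// le_eqVlt; apply/orP; left; apply/eqP; ring.
    rewrite -/S; set q := \sum_(p <- _) _ => h1 h2.
    have : b * (q - t) <= 0 by rewrite pmulr_rle0//; lra.
    lra.
  by rewrite gerBl expR_ge0.
have cY i j : covariance_form lY (i, j) = \sum_m vY m i * vY m j.
  exact: covariance_form_enum.
have cX i j : covariance_form lX (i, j) = \sum_k vX k i * vX k j + a ^+ 2.
  by rewrite /covariance_form big_cons -[X in _ + X]/(covariance_form _ (i, j))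
    covariance_form_enum addrC.
have slep : gavgs (map (scalev b) lY) f x0 <= gavgs (map (scalev b) lX) f x0.
  apply: (slepian x0 sf H0) => [i|i j ij]; rewrite !covariance_form_scalev cX cY.
    congr (_ * _); transitivity (2 : R).
      by rewrite -(dX i); congr (_ + _); apply: eq_bigr => k _; rewrite expr2.
    by rewrite -(dY i); apply: eq_bigr => k _; rewrite expr2.
  by apply: ler_wpM2l; [exact: sqr_ge0|exact: cXY].
(* The common Gaussian is averaged into the test function, since it is not one of the variables
   [Z k]. *)
pose g := gavg (fun=> b * a) f.
have ng : bounded_lipschitz g by exact: bounded_lipschitz_gavg.
have g0 y : 0 <= g y.
  by apply: Rintegral_ge0 => s _; have /andP[] := f01 (ray y (fun=> b * a) s).
have EX : gavgs (map (scalev b) lX) f x0 =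
    gavgs (map (fun k => scalev b (vX k)) (enum K)) g x0.
  by rewrite /= gavg_gavgsC// -map_comp.
set Bad := [set w | _].
have BadE : Bad = \bigcup_(i in [set: I]) [set w | t' <= \sum_k Z k w * vX k i].
  by apply/seteqP; split => [w [i wi]|w [i _ wi]]; exists i.
have mS i : measurable_fun [set: T] (fun w => \sum_k Z k w * vX k i).
  by apply: measurable_sum => k; exact: measurable_funM.
have mBad : measurable Bad.
  rewrite BadE; apply: fin_bigcup_measurable => // i _.
  rewrite (_ : [set w | _] = (fun w => \sum_k Z k w * vX k i) @^-1` `[t', +oo[%classic).
    by rewrite -[_ @^-1` _]setTI; exact: mS.
  by apply/seteqP; split => w /=; rewrite in_itv/= andbT.
pose Xw w i := x0 i + \sum_(k <- enum K) Z k w * scalev b (vX k) i.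
have XwE w i : Xw w i = b * (\sum_k Z k w * vX k i - t).
  rewrite /Xw /x0 big_enum mulrBr mulr_sumr addrC; congr (_ - _).
  by apply: eq_bigr => k _; rewrite /scalev mulrCA.
have law := ge0_integral_gaussian_family iidZ (fun k => scalev b (vX k)) x0
  (enum_uniq K) ng g0.
have up : (\int[P]_w (g (Xw w))%:E <= (1 - 2^-1 * fine (P Bad))%:E)%E.
  apply: (@le_trans _ _ (\int[P]_w (1 - 2^-1 * \1_Bad w)%:E)%E).
    apply: ge0_le_integral => //.
    - by move=> w _; rewrite lee_fin.
    - apply/measurable_EFinP; have [_ _ mg] := ng; apply: (mg _ T) => i.
      rewrite (_ : (fun w => _) = (fun w => b * (\sum_k Z k w * vX k i - t))).
        by apply: measurable_funM => //; exact: measurable_funB.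
      by apply/funext => w; rewrite XwE.
    - apply/measurable_EFinP; apply: measurable_funB => //.
      by apply: measurable_funM => //; exact: measurable_indic.
    - move=> w _; rewrite lee_fin; apply: le_trans (gavg_common_shift_le _ _ nf) _.
      rewrite lerD2l lerN2 ler_wpM2l// indicE.
      have [/set_mem[i wi]|_] := boolP (w \in Bad); last by rewrite ler0n.
      suff -> : [exists i, 3 <= Xw w i] by [].
      apply/existsP; exists i; rewrite XwE -bE ler_pM2l//; lra.
  rewrite le_eqVlt; apply/orP; left; apply/eqP.
  under eq_integral do rewrite EFinB EFinM.
  rewrite integralB//=; last 2 first.
  - exact: finite_measure_integrable_cst.
  - apply: integrableZl => //; exact: integrable_indic.
  rewrite integralZl//; last exact: integrable_indic.
  have -> : (\int[P]__ 1 = 1)%E by rewrite integral_cst//= probability_setT mule1.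
  by rewrite integral_indic// setIT EFinB EFinM fineK// fin_num_measure.
have := up; rewrite law -EX lee_fin => up'.
have PB : P Bad = (fine (P Bad))%:E by rewrite fineK// fin_num_measure.
rewrite PB lee_fin; lra.
Qed.

End SlepianTail.

(** * The quadratic form of the GUE matrix as a Gaussian family *)

Section HermitianForm.
Variables (R : realType) (n : nat).
Implicit Types (u w : bool * 'I_n -> R) (W : bool * 'I_n * 'I_n -> R).

Definition sqnorm u : R := \sum_j u j ^+ 2.

(* [form_coef u] lists the coefficients of the Gaussian variables in the quadratic
   form [v^* G v] of the trace-zero GUE matrix, where [v = u (false, _) + i u (true, _)]. *)
Definition form_coef u (k : bool * 'I_n * 'I_n) : R :=
  let: (b, p, q) := k in
  if b then u (true, p) * u (false, q) - u (false, p) * u (true, q)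
  else u (false, p) * u (false, q) + u (true, p) * u (true, q) -
       (p == q)%:R * (sqnorm u / n%:R).

Definition gue_form W u : R := \sum_k W k * form_coef u k.

Lemma sum_bool_prod (F : bool * 'I_n -> R) :
  \sum_j F j = \sum_p (F (false, p) + F (true, p)).
Proof.
transitivity (\sum_b \sum_p F (b, p)).
  by rewrite pair_bigA /=; apply: eq_bigr => -[].
by rewrite big_bool /= addrC -big_split.
Qed.

Lemma sum_bool_prod2 (F : bool * 'I_n * 'I_n -> R) :
  \sum_k F k = \sum_p \sum_q (F (false, p, q) + F (true, p, q)).
Proof.
rewrite pair_bigA /=.
transitivity (\sum_(i : bool * 'I_n) \sum_q F (i, q)).
  by rewrite pair_bigA /=; apply: eq_bigr => -[].
rewrite sum_bool_prod -(pair_bigA _ (fun p q => F (false, p, q) + F (true, p, q))) /=.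
by apply: eq_bigr => p _; rewrite big_split.
Qed.

Lemma sum_diag (F : 'I_n -> 'I_n -> R) :
  \sum_p \sum_q (p == q)%:R * F p q = \sum_p F p p.
Proof.
apply: eq_bigr => p _; rewrite (bigD1 p)//= eqxx mul1r big1 ?addr0// => q.
by rewrite eq_sym => /negbTE ->; rewrite mul0r.
Qed.

(* The covariance of [v^* G v] and [w^* G w] is [|<v, w>|^2 - |v|^2 |w|^2 / n]. *)
Lemma sum_form_coef u w : (0 < n)%N ->
  \sum_k form_coef u k * form_coef w k =
  (\sum_j u j * w j) ^+ 2 +
  (\sum_p (u (false, p) * w (true, p) - u (true, p) * w (false, p))) ^+ 2 -
  sqnorm u * sqnorm w / n%:R.
Proof.
move=> n0; have nn : n%:R != 0 :> R by rewrite pnatr_eq0 -lt0n.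
set x := sqnorm u / n%:R; set y := sqnorm w / n%:R.
have su : sqnorm u = \sum_p (u (false, p) ^+ 2 + u (true, p) ^+ 2).
  exact: sum_bool_prod.
have sw : sqnorm w = \sum_p (w (false, p) ^+ 2 + w (true, p) ^+ 2).
  exact: sum_bool_prod.
(* The trace correction is spread over the diagonal, so that the whole identity can be checked for
   each pair [(p, q)] separately. *)
have -> : sqnorm u * sqnorm w / n%:R =
    \sum_p \sum_q (p == q)%:R * (y * (u (false, p) ^+ 2 + u (true, p) ^+ 2) +
      x * (w (false, p) ^+ 2 + w (true, p) ^+ 2) - x * y).
  rewrite sum_diag sumrB big_split /= -!mulr_sumr -su -sw sumr_const card_ord.
  by rewrite /x /y -mulr_natr; field.
rewrite sum_bool_prod2 sum_bool_prod !expr2 !big_distrlr /= -big_split /=.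
rewrite -sumrB; apply: eq_bigr => p _.
rewrite -big_split -sumrB; apply: eq_bigr => q _ /=.
rewrite -/x -/y; case: eqP => [->|_]; rewrite /= ?mul1r ?mul0r; ring.
Qed.

Lemma gue_form_reindex W (s : bool * 'I_n * 'I_n -> bool * 'I_n * 'I_n) u :
  involutive s -> gue_form (fun k => W (s k)) u = \sum_k W k * form_coef u (s k).
Proof.
move=> sK; rewrite /gue_form [RHS](reindex_inj (inv_inj sK)) /=.
by apply: eq_bigr => k _; rewrite sK.
Qed.

(** Permuting the variables by [s] reindexes the covariance sums without changing them. The
    comparison vector has [2 n] real coordinates, hence [(1 - 2 l)^-1] to the power [n]; the bound
    is independent of the size of [I]. *)
Lemma gue_form_tail (dT : measure_display) (T : measurableType dT)
    (P : probability T R) (Z : bool * 'I_n * 'I_n -> {RV P >-> R})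
    (s : bool * 'I_n * 'I_n -> bool * 'I_n * 'I_n) (I : finType)
    (u : I -> bool * 'I_n -> R) (l t t' : R) :
  (0 < n)%N -> iid_std_normal Z -> involutive s -> 0 <= l -> l < 2^-1 ->
  0 < t -> t < t' -> (forall i, sqnorm (u i) = 1) ->
  (P [set w | exists i, (t' <= - gue_form (fun k => Z (s k) w) (u i))%R] <=
   (2 * (expR (- (l * (t ^+ 2 / 2))) * (1 - 2 * l)^-1 ^+ n))%:E)%E.
Proof.
move=> n0 iidZ sK l0 l2 t0 tt' u1.
have nn : n%:R != 0 :> R by rewrite pnatr_eq0 -lt0n.
have n0R : 0 < n%:R :> R by rewrite ltr0n.
have k0 : 0 < 1 - 2 * l by lra.
pose vX k i := - form_coef (u i) (s k).
pose vY j i := Num.sqrt 2 * u i j.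
have s2 : Num.sqrt 2 ^+ 2 = 2 :> R by rewrite sqr_sqrtr.
have a2 : Num.sqrt (1 + n%:R^-1) ^+ 2 = 1 + n%:R^-1 :> R.
  by rewrite sqr_sqrtr// addr_ge0// invr_ge0 ltW.
have cX i j : \sum_k vX k i * vX k j =
    (\sum_m u i m * u j m) ^+ 2 +
    (\sum_p (u i (false, p) * u j (true, p) - u i (true, p) * u j (false, p))) ^+ 2 -
    n%:R^-1.
  transitivity (\sum_k form_coef (u i) k * form_coef (u j) k).
    rewrite [RHS](reindex_inj (inv_inj sK)) /=.
    by apply: eq_bigr => k _; rewrite /vX mulrNN.
  by rewrite sum_form_coef// !u1 mulr1 div1r.
have dXi i : \sum_k vX k i ^+ 2 + Num.sqrt (1 + n%:R^-1) ^+ 2 = 2.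
  under eq_bigr do rewrite expr2.
  rewrite cX a2 [X in _ + X ^+ 2]big1 => [|p _]; last by ring.
  have -> : \sum_m u i m * u i m = 1.
    by rewrite -(u1 i); apply: eq_bigr => m _; rewrite expr2.
  by ring.
have dYi i : \sum_j vY j i ^+ 2 = 2.
  under eq_bigr do rewrite /vY exprMn s2.
  by rewrite -mulr_sumr -/(sqnorm (u i)) u1 mulr1.
have cXY i j : i != j -> \sum_m vY m i * vY m j <=
    \sum_k vX k i * vX k j + Num.sqrt (1 + n%:R^-1) ^+ 2.
  move=> _; rewrite cX a2.
  have -> : \sum_m vY m i * vY m j = 2 * \sum_m u i m * u j m.
    by rewrite mulr_sumr; apply: eq_bigr => m _; rewrite /vY mulrACA -expr2 s2.
  move: (\sum_m _) (\sum_p _) => S A.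
  by have := sqr_ge0 S; have := sqr_ge0 (A - 1); lra.
have := slepian_tail iidZ l0 l2 t0 tt' dYi dXi cXY.
rewrite card_prod card_bool card_ord.
have -> : (Num.sqrt (1 - 2 * l))^-1 ^+ (2 * n) = (1 - 2 * l)^-1 ^+ n.
  by rewrite exprM exprVn sqr_sqrtr// ltW.
have E (w : T) i : - gue_form (fun k => Z (s k) w) (u i) = \sum_k Z k w * vX k i.
  by rewrite (gue_form_reindex (fun k => Z k w))// -sumrN; apply: eq_bigr => k _; rewrite /vX mulrN.
have -> // : [set w | exists i, (t' <= - gue_form (fun k => Z (s k) w) (u i))%R] =
  [set w | exists i, (t' <= \sum_k Z k w * vX k i)%R].
by apply/seteqP; split => w /= [i wi]; exists i; [rewrite -E|rewrite E].
Qed.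

End HermitianForm.

(** * Positivity of the state as positivity of a real quadratic form *)

Section GueMatrix.
Variable R : realType.
Local Notation C := (R[i]).
Local Open Scope complex_scope.

Lemma sum_Complex (J : finType) (x y : J -> R) :
  \sum_j Complex (x j) (y j) = Complex (\sum_j x j) (\sum_j y j) :> C.
Proof.
elim: (index_enum J) => [|j r IH]; first by rewrite !big_nil.
by rewrite !big_cons IH.
Qed.

Lemma gue_tr0E n (W : bool * 'I_n * 'I_n -> R) p q :
  gue_tr0 W p q = Complex
    (2^-1 * (W (false, p, q) + W (false, q, p)) -
      (p == q)%:R * ((\sum_m W (false, m, m)) / n%:R))
    (2^-1 * (W (true, p, q) - W (true, q, p))).
Proof.
have s2 : Num.sqrt 2 * Num.sqrt 2 = 2 :> R by rewrite -expr2 sqr_sqrtr.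
have sn : Num.sqrt 2 != 0 :> R by rewrite gt_eqF// sqrtr_gt0.
have sV : (Num.sqrt 2)^-1 * (Num.sqrt 2)^-1 = 2^-1 :> R by rewrite -invfM s2.
set Gp := ((Num.sqrt 2)^-1)%:C *: (Gtilde W + adjmx (Gtilde W)).
have GpE i j : Gp i j = Complex (2^-1 * (W (false, i, j) + W (false, j, i)))
    (2^-1 * (W (true, i, j) - W (true, j, i))).
  rewrite !mxE; apply/eqP; rewrite eq_complex /= !mul0r subr0 addr0 -sV.
  by apply/andP; split; apply/eqP; ring.
have trE : \tr Gp = (\sum_m W (false, m, m))%:C.
  rewrite /mxtrace; under eq_bigr do rewrite GpE.
  rewrite sum_Complex; congr Complex.
    by apply: eq_bigr => m _; field.
  by rewrite big1// => m _; rewrite subrr mulr0.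
rewrite /gue_tr0 -/Gp mxE [X in _ + X]mxE [X in _ - X]mxE GpE trE.
have -> : (\sum_m W (false, m, m))%:C / n%:R = ((\sum_m W (false, m, m)) / n%:R)%:C.
  by rewrite rmorphM fmorphV rmorph_nat.
apply/eqP; rewrite eq_complex; case: (p == q).
  by rewrite mulr1n mul1r /= subr0 !eqxx.
by rewrite mulr0n mul0r !subr0 !eqxx.
Qed.

Lemma rho_stateE (alpha : R) d (W : bool * 'I_(d * d) * 'I_(d * d) -> R) p q :
  rho_state alpha W p q = Complex
   ((d%:R ^+ 2)^-1 * ((p == q)%:R + alpha / d%:R *
     (2^-1 * (W (false, p, q) + W (false, q, p)) -
      (p == q)%:R * ((\sum_m W (false, m, m)) / (d * d)%:R))))
   ((d%:R ^+ 2)^-1 * (alpha / d%:R * (2^-1 * (W (true, p, q) - W (true, q, p))))).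
Proof.
rewrite /rho_state mxE mxE [X in _ * (X + _)]mxE [X in _ * (_ + X)]mxE gue_tr0E.
apply/eqP; rewrite eq_complex.
by case: (p == q); rewrite ?mulr1n ?mulr0n /=; apply/andP; split; apply/eqP; ring.
Qed.

(** The partial transposition moves entry [(p, q)] to [(s1 p q, s1 q p)]. This is compatible with
    swapping [p] and [q] and fixes the diagonal, so the Hermitian symmetrisation, the identity and
    the trace correction are respected. *)
Lemma ptrans_rho_state (alpha : R) d :
  exists2 s : bool * 'I_(d * d) * 'I_(d * d) -> bool * 'I_(d * d) * 'I_(d * d),
    involutive s & forall W : bool * 'I_(d * d) * 'I_(d * d) -> R,
    ptrans (rho_state alpha W) = rho_state alpha (fun k => W (s k)).
Proof.
have [s1 [s1K s1d s1E s1P]] : exists s1 : 'I_(d * d) -> 'I_(d * d) -> 'I_(d * d),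
    [/\ forall p q, s1 (s1 p q) (s1 q p) = p, forall p, s1 p p = p,
       forall p q, (s1 p q == s1 q p) = (p == q) &
       forall (A : 'M[C]_(d * d)) p q, ptrans A p q = A (s1 p q) (s1 q p)].
  exists (fun p q => mxtens_index ((mxtens_unindex p).1, (mxtens_unindex q).2)).
  split=> [p q|p|p q|A p q].
  - rewrite !mxtens_indexK.
    rewrite -[LHS]/(mxtens_index ((mxtens_unindex p).1, (mxtens_unindex p).2)).
    by rewrite -surjective_pairing mxtens_unindexK.
  - by rewrite -surjective_pairing mxtens_unindexK.
  - rewrite (can_eq (@mxtens_indexK _ _)) xpair_eqE.
    rewrite -(can_eq (@mxtens_unindexK d d)).
    case: (mxtens_unindex p) (mxtens_unindex q) => a b [a' b'].
    by rewrite xpair_eqE -[(a, b).1]/a -[(a, b).2]/b -[(a', b').1]/a' -[(a', b').2]/b'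
      (eq_sym b').
  - by rewrite mxE.
exists (fun k => (k.1.1, s1 k.1.2 k.2, s1 k.2 k.1.2)).
  by move=> [[b p] q]; rewrite /= !s1K.
move=> W; apply/matrixP => p q; rewrite [LHS]s1P.
rewrite [LHS]rho_stateE.
rewrite [RHS]rho_stateE.
rewrite s1E.
have -> : \sum_m W (false, s1 m m, s1 m m) = \sum_m W (false, m, m).
  by apply: eq_bigr => m _; rewrite s1d.
by [].
Qed.

Lemma adjmx_rho_state (alpha : R) d (W : bool * 'I_(d * d) * 'I_(d * d) -> R) :
  Defs.hermitian (rho_state alpha W).
Proof.
apply/matrixP => p q; rewrite mxE !rho_stateE eq_sym; apply/eqP; rewrite eq_complex /=.
by apply/andP; split; apply/eqP; ring.
Qed.

(** Entries of [G] average [W] over [(p, q)] and [(q, p)], while [gue_form] attaches each variable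
    to one position; the two double sums agree only after symmetrisation. *)
Lemma sum2_swap (J : finType) (F G : J -> J -> R) :
  (forall p q, F p q + F q p = G p q + G q p) ->
  \sum_p \sum_q F p q = \sum_p \sum_q G p q.
Proof.
move=> FG; have dbl (H : J -> J -> R) :
    \sum_p \sum_q (H p q + H q p) = 2 * \sum_p \sum_q H p q.
  under eq_bigr do rewrite big_split /=.
  by rewrite big_split /= [X in _ + X]exchange_big /= mulr2n mulrDl !mul1r.
have : 2 * \sum_p \sum_q F p q = 2 * \sum_p \sum_q G p q.
  by rewrite -!dbl; apply: eq_bigr => p _; apply: eq_bigr => q _; rewrite FG.
by move=> h; lra.
Qed.

Definition cvec n (u : bool * 'I_n -> R) : 'cV[C]_n :=
  \col_p Complex (u (false, p)) (u (true, p)).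

Lemma rho_state_form (alpha : R) d (W : bool * 'I_(d * d) * 'I_(d * d) -> R)
    (u : bool * 'I_(d * d) -> R) :
  (adjmx (cvec u) *m rho_state alpha W *m cvec u) 0 0 =
  ((d%:R ^+ 2)^-1 * (sqnorm u + alpha / d%:R * gue_form W u))%:C.
Proof.
set k := (d%:R ^+ 2)^-1; set c := alpha / d%:R; set N : R := (d * d)%:R.
pose S := \sum_m W (false, m, m).
pose Rm p q := u (false, p) * u (false, q) + u (true, p) * u (true, q).
pose Im p q := u (false, p) * u (true, q) - u (true, p) * u (false, q).
pose re p q := k * ((p == q)%:R + c *
     (2^-1 * (W (false, p, q) + W (false, q, p)) - (p == q)%:R * (S / N))).
pose im p q := k * (c * (2^-1 * (W (true, p, q) - W (true, q, p)))).
have -> : (adjmx (cvec u) *m rho_state alpha W *m cvec u) 0 0 =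
    \sum_q \sum_p Complex (Rm p q * re p q - Im p q * im p q)
      (Rm p q * im p q + Im p q * re p q).
  rewrite mxE; apply: eq_bigr => q _; rewrite mxE mulr_suml; apply: eq_bigr => p _.
  rewrite rho_stateE !mxE -/k -/c -/S -/N; apply/eqP; rewrite eq_complex /=.
  by apply/andP; split; apply/eqP; rewrite /Rm /Im /re /im; ring.
under eq_bigr do rewrite sum_Complex.
rewrite sum_Complex; congr Complex; last first.
  (* The imaginary part has a summand antisymmetric in [p] and [q], hence vanishes. *)
  transitivity (\sum_(q : 'I_(d * d)) \sum_(p : 'I_(d * d)) (0 : R)).
    apply: sum2_swap => p q; rewrite /Rm /Im /re /im (eq_sym q p); ring.
  by rewrite big1// => p _; rewrite big1.
have sqE : \sum_p \sum_q (p == q)%:R * Rm p q = sqnorm u.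
  rewrite sum_diag /sqnorm sum_bool_prod; apply: eq_bigr => p _.
  by rewrite /Rm !expr2.
rewrite exchange_big /=.
transitivity (\sum_p \sum_q (k * ((1 - c * (S / N)) * ((p == q)%:R * Rm p q)) +
   k * (c * (W (false, p, q) * Rm p q - W (true, p, q) * Im p q)))).
  apply: sum2_swap => p q; rewrite /Rm /Im /re /im (eq_sym q p).
  by move: (S / N) (k) (c) => S' k' c'; field.
under eq_bigr do rewrite big_split /= -!mulr_sumr.
rewrite big_split /= -!mulr_sumr sqE.
have -> : gue_form W u = \sum_p \sum_q
    (W (false, p, q) * Rm p q - W (true, p, q) * Im p q) - sqnorm u / N * S.
  have -> : S = \sum_p \sum_q (p == q)%:R * W (false, p, q).
    by rewrite (sum_diag (fun p q => W (false, p, q))).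
  rewrite /gue_form sum_bool_prod2.
  rewrite mulr_sumr -sumrB; apply: eq_bigr => p _.
  rewrite mulr_sumr -sumrB; apply: eq_bigr => q _.
  by rewrite /form_coef /Rm /Im -/N; ring.
by ring.
Qed.

Lemma psd_rho_stateP (alpha : R) d (W : bool * 'I_(d * d) * 'I_(d * d) -> R) :
  (0 < d)%N -> psd (rho_state alpha W) <->
  (forall u, 0 <= sqnorm u + alpha / d%:R * gue_form W u).
Proof.
move=> d0; have k0 : 0 < (d%:R ^+ 2)^-1 :> R by rewrite invr_gt0 exprn_gt0// ltr0n.
split=> [[_ H] u|H].
  by have := H (cvec u); rewrite rho_state_form ler0c pmulr_rge0.
split; first exact: adjmx_rho_state.
move=> v; pose u (j : bool * 'I_(d * d)) :=
  if j.1 then complex.Im (v j.2 0) else complex.Re (v j.2 0).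
have -> : v = cvec u.
  apply/matrixP => p q; rewrite mxE (ord1 q) /u /=.
  by case: (v p 0).
by rewrite rho_state_form ler0c pmulr_rge0.
Qed.

End GueMatrix.

(** * From finite families of vectors to all vectors *)

Section GueTail.
Context (R : realType).

Lemma cvg_sumr (J : finType) (F : J -> nat -> R) (l : J -> R) :
  (forall j, F j k @[k --> \oo] --> l j) ->
  \sum_j F j k @[k --> \oo] --> \sum_j l j.
Proof.
move=> Fl; elim: (index_enum J) => [|j r IH].
  by under eq_fun do rewrite big_nil; rewrite big_nil; exact: cvg_cst.
under eq_fun do rewrite big_cons; rewrite big_cons.
by apply: cvgD; [exact: Fl|exact: IH].
Qed.

Lemma rational_approx (J : finType) (u : J -> R) :
  exists v : nat -> {ffun J -> rat}, forall j, ratr (v k j) @[k --> \oo] --> u j.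
Proof.
have near k j : exists q : rat, `|u j - ratr q| < k.+1%:R^-1.
  have k0 : 0 < k.+1%:R^-1 :> R by rewrite invr_gt0 ltr0Sn.
  move: (k.+1%:R^-1) k0 => r r0.
  have uk : u j - r < u j + r by lra.
  have [q] := rat_in_itvoo uk.
  rewrite in_itv /= => /andP[q1 q2]; exists q.
  by rewrite ltr_norml; apply/andP; split; lra.
pose f k := projT1 (choice (near k)).
have fE k j : `|u j - ratr (f k j)| < k.+1%:R^-1 by exact: (projT2 (choice (near k))).
exists (fun k => [ffun j => f k j]) => j; apply/cvgrPdist_lt => e e0.
near=> k; rewrite ffunE; apply: (lt_trans (fE k j)); near: k.
exact: (near_infty_natSinv_lt (PosNum e0)).
Unshelve. all: by end_near. Qed.

(** The form is continuous in [u] and rational vectors are dense. This makes positivity a countable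
    intersection of events, hence measurable. *)
Lemma ge0_rational (n : nat) (W : bool * 'I_n * 'I_n -> R) (c : R) :
  (forall v : {ffun bool * 'I_n -> rat},
     0 <= sqnorm (fun j => ratr (v j) : R) + c * gue_form W (fun j => ratr (v j))) ->
  forall u, 0 <= sqnorm u + c * gue_form W u.
Proof.
move=> H u; have [v vu] := rational_approx u.
have csq : sqnorm (fun j => ratr (v k j) : R) @[k --> \oo] --> sqnorm u.
  apply: cvg_sumr => j; rewrite expr2; under eq_fun do rewrite expr2.
  exact: cvgM.
have cf : gue_form W (fun j => ratr (v k j)) @[k --> \oo] --> gue_form W u.
  apply: cvg_sumr => -[[b p] q]; apply: cvgM; first exact: cvg_cst.
  rewrite /form_coef; case: b.
    by apply: cvgB; apply: cvgM.
  apply: cvgB; first by apply: cvgD; apply: cvgM.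
  by apply: cvgM; [exact: cvg_cst|apply: cvgM => //; exact: cvg_cst].
have cQ : (sqnorm (fun j => ratr (v k j) : R) + c * gue_form W (fun j => ratr (v k j)))
    @[k --> \oo] --> sqnorm u + c * gue_form W u.
  by apply: cvgD => //; apply: cvgM => //; exact: cvg_cst.
rewrite -(cvg_lim (@Rhausdorff R) cQ); apply: limr_ge; first exact: cvgP cQ.
by near=> k; exact: H.
Unshelve. all: by end_near. Qed.

Lemma sqnorm_scale (n : nat) (k : R) (u : bool * 'I_n -> R) :
  sqnorm (fun j => k * u j) = k ^+ 2 * sqnorm u.
Proof. by rewrite /sqnorm mulr_sumr; apply: eq_bigr => j _; rewrite exprMn. Qed.

Lemma gue_form_scale (n : nat) (W : bool * 'I_n * 'I_n -> R) (k : R) u :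
  gue_form W (fun j => k * u j) = k ^+ 2 * gue_form W u.
Proof.
rewrite /gue_form mulr_sumr; apply: eq_bigr => -[[b p] q] _.
by rewrite /form_coef sqnorm_scale; case: b; ring.
Qed.

Lemma sqnorm_ge0 (n : nat) (u : bool * 'I_n -> R) : 0 <= sqnorm u.
Proof. by apply: sumr_ge0 => j _; exact: sqr_ge0. Qed.

Lemma gue_form_sqnorm0 (n : nat) (W : bool * 'I_n * 'I_n -> R) u :
  sqnorm u = 0 -> gue_form W u = 0.
Proof.
move=> u0; have uE : u = (fun j => 0 * u j).
  apply/funext => j; rewrite mul0r; apply/eqP; rewrite -sqrf_eq0; apply/eqP.
  by apply: (psumr_eq0P _ u0) => // i _; exact: sqr_ge0.
by rewrite uE gue_form_scale expr0n mul0r.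
Qed.

(** Failure of positivity is contained in the increasing union of the events that one of the first
    [N] normalised rational vectors violates the bound [c^-1]. Each has the same probability bound,
    which survives the limit by continuity from below. *)
Lemma gue_form_positivity_tail (n : nat) (dT : measure_display)
    (T : measurableType dT) (P : probability T R)
    (Z : bool * 'I_n * 'I_n -> {RV P >-> R})
    (s : bool * 'I_n * 'I_n -> bool * 'I_n * 'I_n) (l t c : R) :
  (0 < n)%N -> iid_std_normal Z -> involutive s -> 0 <= l -> l < 2^-1 ->
  0 < t -> 0 < c -> t < c^-1 ->
  let good := [set w | forall u, (0 <= sqnorm u + c * gue_form (fun k => Z (s k) w) u)%R] in
  measurable good /\
  (P (~` good) <= (2 * (expR (- (l * (t ^+ 2 / 2))) * (1 - 2 * l)^-1 ^+ n))%:E)%E.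
Proof.
move=> n0 iidZ sK l0 l2 t0 c0 tc good; set B := 2 * _.
have cn : c != 0 by rewrite gt_eqF.
pose W w (k : bool * 'I_n * 'I_n) := Z (s k) w.
(* An enumeration of all rational vectors; codes that decode to nothing yield the zero vector. *)
pose rv (m : nat) : bool * 'I_n -> R :=
  let v := odflt [ffun=> 0] (unpickle m : option {ffun bool * 'I_n -> rat}) in
  fun j => ratr (v j).
(* A unit vector standing in for the zero vector, so that every [un m] has norm 1. A zero [rv m]
   never witnesses a failure. *)
pose e0 (j : bool * 'I_n) : R := (j == (false, Ordinal n0))%:R.
have e01 : sqnorm e0 = 1.
  rewrite /sqnorm (bigD1 (false, Ordinal n0))//= /e0 eqxx expr1n big1 ?addr0//.
  by move=> j /negbTE ->; rewrite expr0n.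
pose un m := if sqnorm (rv m) == 0 then e0 else
  fun j => (Num.sqrt (sqnorm (rv m)))^-1 * rv m j.
have un1 m : sqnorm (un m) = 1.
  rewrite /un; case: eqP => // /eqP r0; rewrite sqnorm_scale exprVn sqr_sqrtr ?mulVf//.
  exact: sqnorm_ge0.
have mform u : measurable_fun [set: T] (fun w => gue_form (W w) u).
  by apply: measurable_sum => k; exact: measurable_funM.
have goodE : good = \bigcap_m [set w | (0 <= sqnorm (rv m) + c * gue_form (W w) (rv m))%R].
  apply/seteqP; split => w; first by move=> wg m _; exact: wg.
  move=> wg; apply: ge0_rational => v; have := wg (pickle v) I.
  by rewrite /= /rv pickleK.
have mgood : measurable good.
  rewrite goodE; apply: bigcapT_measurable => m.
  rewrite (_ : [set w | _] = (fun w => sqnorm (rv m) + c * gue_form (W w) (rv m)) @^-1`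
      `[0, +oo[%classic).
    rewrite -[_ @^-1` _]setTI; apply: measurable_funD => //.
    by apply: measurable_funM.
  by apply/seteqP; split => w /=; rewrite in_itv/= andbT.
split=> //.
pose A N := [set w | exists i : 'I_N, (c^-1 <= - gue_form (W w) (un i))%R].
have mA N : measurable (A N).
  rewrite (_ : A N = \bigcup_(i in [set: 'I_N])
      ((fun w => - gue_form (W w) (un i)) @^-1` `[c^-1, +oo[%classic)).
    apply: fin_bigcup_measurable => // i _.
    by rewrite -[_ @^-1` _]setTI; apply: measurableT_comp.
  apply/seteqP; split => w /=; first by move=> [i wi]; exists i => //=; rewrite in_itv/= andbT.
  by move=> [i _]; rewrite /= in_itv/= andbT => wi; exists i.
have ndA : nondecreasing_seq A.
  move=> N M NM; apply/subsetPset => w [i wi].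
  by exists (widen_ord NM i).
have mU : measurable (\bigcup_N A N) by exact: bigcupT_measurable.
have sub : ~` good `<=` \bigcup_N A N.
  move=> w /=; rewrite goodE => /existsNP[m /not_implyP[_ /negP]].
  rewrite -ltNge => Q0; exists m.+1 => //; exists (Ordinal (ltnSn m)) => /=.
  have [r0|r0] := eqVneq (sqnorm (rv m)) 0.
    by move: Q0; rewrite r0 gue_form_sqnorm0// mulr0 addr0 ltxx.
  have rp : 0 < sqnorm (rv m) by rewrite lt_neqAle eq_sym r0 sqnorm_ge0.
  rewrite /un (negbTE r0) gue_form_scale exprVn sqr_sqrtr ?(ltW rp)//.
  rewrite -mulrN ler_pdivlMl// ler_pdivrMr//.
  move: Q0; lra.
apply: (@le_trans _ _ (P (\bigcup_N A N))).
  by apply: le_measure => //; rewrite inE//; exact: measurableC.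
have cvA := nondecreasing_cvg_mu (mu := P) mA mU ndA.
rewrite -(cvg_lim _ cvA)//; apply: lime_le; first by apply/cvg_ex; eexists; exact: cvA.
near=> N; exact: (@gue_form_tail R n dT T P Z s 'I_N (fun i => un i) l t c^-1).
Unshelve. all: by end_near. Qed.

End GueTail.

(** * Choice of the constants and combination of the two positivity bounds *)

Theorem theorem13 (R : realType) (alpha : R) :
  0 < alpha -> alpha < 2^-1 ->
  exists c : R, 0 < c /\
    forall (d : nat) (dT : measure_display) (T : measurableType dT)
           (P : probability T R)
           (Z : bool * 'I_(d * d) * 'I_(d * d) -> {RV P >-> R}),
      iid_std_normal Z ->
      ((1 - 2 * expR (- c * (d%:R ^+ 2)))%:E <=
       P [set w | psd (rho_state alpha (fun k => Z k w)) /\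
                  psd (ptrans (rho_state alpha (fun k => Z k w)))])%E.

Proof.
move=> a0 a2.
(* [tau] is the midpoint of 2 and [alpha^-1]. At [t = tau d] and [l = y / 2] the tail factor is the
   power [d * d] of [q] below, with [kappa] the resulting exponent. *)
pose tau := 1 + (2 * alpha)^-1; pose kappa := tau ^+ 2 / 4.
have aV : 2 < alpha^-1 by rewrite -[ltLHS]invrK ltf_pV2 ?posrE// invr_gt0.
have an : alpha != 0 by rewrite gt_eqF.
have tauE : tau = 1 + alpha^-1 / 2 by rewrite /tau invfM mulrC.
have tau2 : 2 < tau by rewrite tauE; lra.
have tauV : tau < alpha^-1 by rewrite tauE; lra.
have k1 : 1 < kappa by rewrite /kappa; nra.
have kn : kappa != 0 by rewrite gt_eqF//; lra.
(* The maximiser of [y (kappa - 1 - kappa y)], the excess over 1 of [(1 + kappa y) (1 - y)];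
   positive excess forces [q < 1]. *)
pose y := (kappa - 1) / (2 * kappa).
have yE : y * (2 * kappa) = kappa - 1 by rewrite /y divfK// mulf_neq0.
have y0 : 0 < y by rewrite /y divr_gt0//; lra.
have y1 : y < 1 by rewrite /y ltr_pdivrMr; lra.
have ky1 : 1 < (1 + kappa * y) * (1 - y).
  have -> : (1 + kappa * y) * (1 - y) = 1 + y * (kappa - 1 - kappa * y) by ring.
  have : 0 < y * (kappa - 1 - kappa * y) by rewrite mulr_gt0//; lra.
  lra.
pose q := expR (- (kappa * y)) / (1 - y).
have y1' : 0 < 1 - y by lra.
have q0 : 0 < q by rewrite divr_gt0// expR_gt0.
have q1 : q < 1.
  rewrite /q expRN -invfM invf_lt1 ?mulr_gt0 ?expR_gt0//.
  apply: (lt_le_trans ky1); rewrite ler_pM2r//; exact: expR_ge1Dx.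
(* The halving makes the power [d * d] of [q] equal to [x ^+ 2] rather than [x]. *)
pose c := - ln q / 2.
have c0 : 0 < c by rewrite /c divr_gt0// oppr_gt0 ln_lt0// q0.
exists c; split=> // d dT T P Z iidZ.
(* For [d = 0] the claimed lower bound is [-1]. *)
have [d0|d0] := posnP d.
  have -> : expR (- c * d%:R ^+ 2) = 1 by rewrite d0 expr0n mulr0 expR0.
  by apply: (@le_trans _ _ 0%E) => //; rewrite lee_fin; lra.
have d0R : 0 < d%:R :> R by rewrite ltr0n.
have dn : d%:R != 0 :> R by rewrite gt_eqF.
have n0 : (0 < d * d)%N by rewrite muln_gt0 d0.
have [s sK ptE] := ptrans_rho_state alpha d.
set x := expR (- c * d%:R ^+ 2).
have x0 : 0 < x by exact: expR_gt0.
have bound : 2 * (expR (- (y / 2 * ((tau * d%:R) ^+ 2 / 2))) *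
    (1 - 2 * (y / 2))^-1 ^+ (d * d)) = 2 * x ^+ 2.
  congr (_ * _).
  have -> : expR (- (y / 2 * ((tau * d%:R) ^+ 2 / 2))) = expR (- (kappa * y)) ^+ (d * d).
    by rewrite -expRM_natl; congr expR; rewrite /kappa natrM; field.
  have -> : 1 - 2 * (y / 2) = 1 - y by field.
  rewrite -exprMn -/q -[in LHS](lnK q0) -expRM_natl -expRM_natl natrM /c.
  by congr expR; field.
have c0' : 0 < alpha / d%:R by rewrite divr_gt0.
have tc : tau * d%:R < (alpha / d%:R)^-1 by rewrite invf_div mulrC ltr_pM2l.
have t0 : 0 < tau * d%:R by rewrite mulr_gt0//; lra.
have l0 : 0 <= y / 2 by lra.
have l2 : y / 2 < 2^-1 by lra.
have [mG PG] := gue_form_positivity_tail (s := id) n0 iidZ (fun=> erefl) l0 l2 t0 c0' tc.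
have [mH PH] := gue_form_positivity_tail n0 iidZ sK l0 l2 t0 c0' tc.
move: mG PG mH PH; rewrite bound; set G := [set w | _]; set H := [set w | _].
move=> mG PG mH PH.
have -> : [set w | psd (rho_state alpha (fun k => Z k w)) /\
    psd (ptrans (rho_state alpha (fun k => Z k w)))] = G `&` H.
  apply/seteqP; split => w /=; rewrite ptE.
    by move=> [/(psd_rho_stateP _ _ d0) ? /(psd_rho_stateP _ _ d0) ?].
  by move=> [? ?]; split; apply/(psd_rho_stateP _ _ d0).
(* For [x > 1/2] the claimed bound is negative; otherwise the total failure probability [4 x^2] is
   at most [2 x]. *)
have [x2|x2] := leP x 2^-1; last first.
  by apply: (@le_trans _ _ 0%E) => //; rewrite lee_fin; lra.
have mGH : measurable (G `&` H) by exact: measurableI.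
have PC : (P (~` (G `&` H)) <= (2 * x ^+ 2 + 2 * x ^+ 2)%:E)%E.
  rewrite setCI EFinD; apply: le_trans (leeD PG PH).
  by apply: measureU2; exact: measurableC.
have PE : (P (G `&` H) = 1 - P (~` (G `&` H)))%E.
  by rewrite -probability_setC ?setCK//; exact: measurableC.
rewrite PE EFinB leeB//; apply: le_trans PC _; rewrite lee_fin.
by nra.
Qed.
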